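(* Let $c\neq0$, let $\phi:M^2\to N^3(c)$ be an oriented isometric immersion, let $\eta\in\mathbb C$ with $4\eta^2=c$, and let $$\mathscr B_c:=D^2+2\eta\,\omega D-2\eta H\omega+|A|^2-H^2-2c .$$ Then every monic scalar--chiral factorization of $\mathscr B_c$ is uniquely of the form $$\mathscr B_c=\bigl(D+H+(\beta+2\eta)\omega\bigr)\bigl(D-H+\beta\,\omega\bigr)$$ for a smooth complex-valued function $\beta$. It exists (with a given $\beta$) if and only if $$\operatorname{grad}\beta=J\operatorname{grad}H,\qquad \beta(\beta+2\eta)+|A|^2-2c=0 .$$
   Context: $N^3(c)$ is an oriented Riemannian three-dimensional space form of constant sectional curvature $c$; $M^2$ is an oriented surface immersed with unit normal $\xi$ and induced metric $g$. The shape operator is $\nabla^N_X\xi=-A(X)$, $H=\frac12\operatorname{tr}A$, $|A|^2=\operatorname{tr}(A^2)$. $\Sigma M$ is the complex spinor bundle of a spin structure on $M$; Clifford multiplication satisfies $X\cdot Y+Y\cdot X=-2g(X,Y)$. $\omega=e_1\cdot e_2$ for a positively oriented orthonormal frame, acting by Clifford multiplication, and $D\Psi=e_1\cdot\nabla_{e_1}\Psi+e_2\cdot\nabla_{e_2}\Psi$. $J$ is rotation by $+\pi/2$ on $TM$; for complex-valued functions $\operatorname{grad}$ and $J$ are extended complex-linearly. A monic scalar--chiral factorization of $\mathscr B_c$ on an open set is an operator identity $\mathscr B_c=(D+a+b\,\omega)(D+p+q\,\omega)$ on sections of $\Sigma M$ there, with $a,b,p,q$ smooth complex-valued functions on that set;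 $\beta$ is defined on the same set. *)

(* Defs.v *)
From mathcomp Require Import all_boot all_order all_algebra.
From mathcomp Require Import complex.
From mathcomp Require Import all_classical all_reals all_analysis.

Set Implicit Arguments.
Unset Strict Implicit.
Unset Printing Implicit Defensive.
Import Order.TTheory GRing.Theory Num.Theory.
Import numFieldNormedType.Exports.
Local Open Scope classical_set_scope.
Local Open Scope ring_scope.

(** * Smooth maps between normed spaces *)

(* All iterated directional derivatives up to order [k] exist and are
   continuous at the points of [U]; only used for [U] open. *)
Fixpoint Ck (R : realType) (V W : normedModType R) (k : nat) (U : set V)
    (f : V -> W) : Prop :=
  (forall x, U x -> {for x, continuous f}) /\
  if k is k'.+1 then
    forall v, (forall x, U x -> derivable f x v) /\ Ck k' U ('D_v f)
  else True.

Definition Cinfty (R : realType) (V W : normedModType R) (U : set V)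
  (f : V -> W) : Prop := forall k, Ck k U f.

(** * Smooth manifolds *)

(* [dom i] is the domain of the chart [i], [coord i] its coordinate map and
   [point i] the inverse of the latter; outside [dom i] and its image these
   functions are arbitrary.  [chart_at] witnesses that the charts cover. *)
Record manifold (R : realType) (n : nat) := Manifold {
  carrier :> topologicalType;
  chart : Type;
  dom : chart -> set carrier;
  coord : chart -> carrier -> 'rV[R]_n;
  point : chart -> 'rV[R]_n -> carrier;
  chart_at : carrier -> chart;
  manifold_hausdorff : hausdorff_space carrier;
  manifold_second_countable : @second_countable carrier;
  dom_chart_at : forall x, dom (chart_at x) x;
  dom_open : forall i, open (dom i);
  coord_open : forall i, open (coord i @` dom i);
  coordK : forall i x, dom i x -> point i (coord i x) = x;
  coord_continuous : forall i x, dom i x -> {for x, continuous (coord i)};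
  point_continuous : forall i y, (coord i @` dom i) y ->
    {for y, continuous (point i)};
  transition_smooth : forall i j,
    Cinfty (coord i @` (dom i `&` dom j)) (coord j \o point i) }.

Arguments chart {R n}.
Arguments dom {R n m} : rename.
Arguments coord {R n m} : rename.
Arguments point {R n m} : rename.
Arguments chart_at {R n m} : rename.

Definition oriented (R : realType) (n : nat) (M : manifold R n) : Prop :=
  forall (i j : chart M) (x : M), dom i x -> dom j x ->
    0 < \det (jacobian (coord j \o point i) (coord i x)).

(* Derivative of [f], read in the chart [i], at [x] in the direction of the
   tangent vector whose components in the chart [i] are [v].  For
   [f = coord j] it is the change of components of tangent vectors from the
   chart [i] to the chart [j]. *)
Definition dif (R : realType) (n : nat) (M : manifold R n)
    (W : normedModType R) (i : chart M) (f : M -> W) (x : M)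
    (v : 'rV[R]_n) : W :=
  'D_v (f \o point i) (coord i x).

Definition smooth_on (R : realType) (n : nat) (M : manifold R n)
    (W : normedModType R) (U : set M) (f : M -> W) : Prop :=
  forall i : chart M, Cinfty (coord i @` (dom i `&` U)) (f \o point i).

Definition smooth_map (R : realType) (m n : nat) (M : manifold R m)
    (N : manifold R n) (f : M -> N) : Prop :=
  continuous f /\
  forall k : chart N, smooth_on (f @^-1` dom k) (coord k \o f).

(** * Riemannian metrics, Levi-Civita connection, curvature *)

Definition bil (R : realType) (n : nat) (G : 'M[R]_n) (u v : 'rV[R]_n) : R :=
  (u *m G *m v^T) 0 0.

Record riemannian (R : realType) (n : nat) := Riemannian {
  rbase :> manifold R n;
  metric : chart rbase -> rbase -> 'M[R]_n;
  metric_smooth : forall i, smooth_on (dom i) (metric i);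
  metric_sym : forall i x, dom i x -> (metric i x)^T = metric i x;
  metric_pos : forall i x, dom i x -> forall v, v != 0 ->
    0 < bil (metric i x) v v;
  metric_change : forall i j x, dom i x -> dom j x -> forall u v,
    bil (metric i x) u v =
    bil (metric j x) (dif i (coord j) x u) (dif i (coord j) x v) }.

Arguments metric {R n} M i x : rename.

(* The vector of components [Gamma^k_ab u^a v^b], from the Koszul formula for
   fields with constant components in the chart [i]. *)
Definition christoffel (R : realType) (n : nat) (M : riemannian R n)
    (i : chart M) (x : M) (u v : 'rV[R]_n) : 'rV[R]_n :=
  (\row_l (2^-1 * (bil (dif i (metric M i) x u) v (delta_mx 0 l)
                 + bil (dif i (metric M i) x v) u (delta_mx 0 l)
                 - bil (dif i (metric M i) x (delta_mx 0 l)) u v)))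
  *m invmx (metric M i x).

(* [R(u,v)w = nabla_u nabla_v w - nabla_v nabla_u w] for [u], [v], [w]
   extended with constant components in the chart [i]. *)
Definition curvature (R : realType) (n : nat) (M : riemannian R n)
    (i : chart M) (x : M) (u v w : 'rV[R]_n) : 'rV[R]_n :=
  dif i (fun y => christoffel i y v w) x u
  - dif i (fun y => christoffel i y u w) x v
  + christoffel i x u (christoffel i x v w)
  - christoffel i x v (christoffel i x u w).

Definition sectional (R : realType) (n : nat) (M : riemannian R n)
    (i : chart M) (x : M) (u v : 'rV[R]_n) : R :=
  let g := bil (metric M i x) in
  g (curvature i x u v v) u / (g u u * g v v - g u v ^+ 2).

Definition geodesic (R : realType) (n : nat) (M : riemannian R n)
    (gam : R -> M) : Prop :=
  continuous gam /\
  forall i : chart M, let c : R -> 'rV[R]_n := coord i \o gam in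
    Cinfty (gam @^-1` dom i) c /\
    forall t, dom i (gam t) ->
      derive1 (derive1 c) t
      + christoffel i (gam t) (derive1 c t) (derive1 c t) = 0.

Definition complete (R : realType) (n : nat) (M : riemannian R n) : Prop :=
  forall (i : chart M) (x : M) (v : 'rV[R]_n), dom i x ->
    exists gam : R -> M,
      [/\ geodesic gam, gam 0 = x & derive1 (coord i \o gam) 0 = v].

Definition space_form (R : realType) (n : nat) (c : R) (N : riemannian R n)
    : Prop :=
  [/\ connected [set: N], complete N &
      forall (i : chart N) (x : N) (u v : 'rV[R]_n), dom i x ->
        row_free (col_mx u v) -> sectional i x u v = c].

(** * Immersed surfaces *)

Definition isometric (R : realType) (m n : nat) (M : riemannian R m)
    (N : riemannian R n) (phi : M -> N) : Prop :=
  forall (i : chart M) (k : chart N) (x : M), dom i x -> dom k (phi x) ->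
    forall u v, bil (metric M i x) u v =
      bil (metric N k (phi x)) (dif i (coord k \o phi) x u)
                               (dif i (coord k \o phi) x v).

(* Covariant derivative, in the chart [k] of [N], of a vector field along
   [phi] with components [xi], in the direction [v] read in the chart [i]. *)
Definition cov (R : realType) (m n : nat) (M : manifold R m)
    (N : riemannian R n) (phi : M -> N) (i : chart M) (k : chart N)
    (xi : M -> 'rV[R]_n) (x : M) (v : 'rV[R]_m) : 'rV[R]_n :=
  dif i xi x v
  + christoffel k (phi x) (dif i (coord k \o phi) x v) (xi x).

Record unit_normal (R : realType) (m n : nat) (M : riemannian R m)
    (N : riemannian R n) (phi : M -> N) := UnitNormal {
  normal :> chart N -> M -> 'rV[R]_n;
  normal_smooth : forall k, smooth_on (phi @^-1` dom k) (normal k);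
  normal_change : forall k l x, dom k (phi x) -> dom l (phi x) ->
    normal l x = dif k (coord l) (phi x) (normal k x);
  normal_unit : forall k x, dom k (phi x) ->
    bil (metric N k (phi x)) (normal k x) (normal k x) = 1;
  normal_orthogonal : forall i k x, dom i x -> dom k (phi x) -> forall v,
    bil (metric N k (phi x)) (normal k x) (dif i (coord k \o phi) x v) = 0 }.

(* A smooth endomorphism field [v |-> v *m A i x] with
   [nabla^N_v xi = - dphi (A v)]. *)
Record shape_operator (R : realType) (m n : nat) (M : riemannian R m)
    (N : riemannian R n) (phi : M -> N) (xi : unit_normal phi) :=
  ShapeOperator {
  shape :> chart M -> M -> 'M[R]_m;
  shape_smooth : forall i, smooth_on (dom i) (shape i);
  shape_change : forall i j x, dom i x -> dom j x -> forall v,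
    dif i (coord j) x (v *m shape i x) = dif i (coord j) x v *m shape j x;
  weingarten : forall i k x, dom i x -> dom k (phi x) -> forall v,
    cov phi i k (xi k) x v = - dif i (coord k \o phi) x (v *m shape i x) }.

Section Curvatures.
Variables (R : realType) (n : nat) (M : riemannian R 2) (N : riemannian R n).
Variables (phi : M -> N) (xi : unit_normal phi) (A : shape_operator xi).

(* The traces do not depend on the chart. *)
Definition mean_curvature (x : M) : R := 2^-1 * \tr (A (chart_at x) x).

Definition norm2_shape (x : M) : R :=
  \tr (A (chart_at x) x *m A (chart_at x) x).

End Curvatures.

(** * Complex-valued functions *)

Definition csmooth_on (R : realType) (n : nat) (M : manifold R n) (U : set M)
    (f : M -> R[i]) : Prop :=
  smooth_on U (fun x => complex.Re (f x) : R) /\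
  smooth_on U (fun x => complex.Im (f x) : R).

Definition cdif (R : realType) (n : nat) (M : manifold R n) (i : chart M)
    (f : M -> R[i]) (x : M) (v : 'rV[R]_n) : R[i] :=
  (dif i (fun y => complex.Re (f y) : R) x v
   +i* dif i (fun y => complex.Im (f y) : R) x v)%C.

Definition grad (R : realType) (n : nat) (M : riemannian R n) (i : chart M)
    (f : M -> R) (x : M) : 'rV[R]_n :=
  (\row_l dif i f x (delta_mx 0 l)) *m invmx (metric M i x).

Definition cgrad (R : realType) (n : nat) (M : riemannian R n) (i : chart M)
    (f : M -> R[i]) (x : M) : 'rV[R[i]]_n :=
  map_mx (real_complex R) (grad i (fun y => complex.Re (f y)) x)
  + 'i%C *: map_mx (real_complex R) (grad i (fun y => complex.Im (f y)) x).

(** * Spin structures and the Dirac operator on surfaces *)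

Section Clifford.
Variable R : realType.

(* The irreducible complex representation of the Clifford algebra:
   [E_a E_b + E_b E_a = - 2 delta_ab]. *)
Definition E1 : 'M[R[i]]_2 := 'i%C *: (delta_mx 0 1 + delta_mx 1 0).
Definition E2 : 'M[R[i]]_2 := delta_mx 1 0 - delta_mx 0 1.
Definition omega : 'M[R[i]]_2 := E1 *m E2.

(* The action of [Spin(2) = U(1)] on spinors, [z] standing for
   [Re z + Im z e1 e2]; this element covers the rotation by [z ^ 2]. *)
Definition spin_action (z : R[i]) : 'M[R[i]]_2 :=
  ((complex.Re z)%:C%C)%:M + (complex.Im z)%:C%C *: omega.

End Clifford.

(* A spin structure, presented by a cocycle over a cover by charts: each chart
   domain carries a positively oriented orthonormal frame [e1], [e2], and the
   [SO(2)]-valued transition functions of these frames are lifted to a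
   [Spin(2)]-valued cocycle [lift].  (Any spin structure is of this form over
   a suitable atlas.)  The components of [e1 i x], [e2 i x] are those in the
   chart [i]. *)
Record spin_structure (R : realType) (M : riemannian R 2) := SpinStructure {
  e1 : chart M -> M -> 'rV[R]_2;
  e2 : chart M -> M -> 'rV[R]_2;
  lift : chart M -> chart M -> M -> R[i];
  e1_smooth : forall i, smooth_on (dom i) (e1 i);
  e2_smooth : forall i, smooth_on (dom i) (e2 i);
  frame_orthonormal : forall i x, dom i x ->
    let g := bil (metric M i x) in
    [/\ g (e1 i x) (e1 i x) = 1, g (e2 i x) (e2 i x) = 1 &
        g (e1 i x) (e2 i x) = 0];
  frame_positive : forall i x, dom i x ->
    0 < \det (col_mx (e1 i x) (e2 i x) : 'M[R]_2);
  lift_smooth : forall i j, csmooth_on (dom i `&` dom j) (lift i j);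
  lift_unit : forall i j x, dom i x -> dom j x -> `|lift i j x| = 1;
  lift_cocycle : forall i j k x, dom i x -> dom j x -> dom k x ->
    lift i k x = lift i j x * lift j k x;
  lift_e1 : forall i j x, dom i x -> dom j x ->
    dif j (coord i) x (e1 j x) =
    complex.Re (lift i j x ^+ 2) *: e1 i x
    + complex.Im (lift i j x ^+ 2) *: e2 i x;
  lift_e2 : forall i j x, dom i x -> dom j x ->
    dif j (coord i) x (e2 j x) =
    - complex.Im (lift i j x ^+ 2) *: e1 i x
    + complex.Re (lift i j x ^+ 2) *: e2 i x }.

Section Dirac.
Variables (R : realType) (M : riemannian R 2) (S : spin_structure M).

(* Rotation by [+pi/2], acting on row vectors on the right: it maps
   [e1 S i x] to [e2 S i x] and [e2 S i x] to [- e1 S i x]. *)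
Definition J (i : chart M) (x : M) : 'M[R]_2 :=
  metric M i x *m ((e1 S i x)^T *m e2 S i x - (e2 S i x)^T *m e1 S i x).

Definition cJ (i : chart M) (x : M) : 'M[R[i]]_2 :=
  map_mx (real_complex R) (J i x).

(* [psi i] is the expression of the spinor field in the spin frame over
   [dom i]. *)
Definition spinor := chart M -> M -> 'cV[R[i]]_2.

Definition spinor_field (U : set M) (psi : spinor) : Prop :=
  (forall i a, csmooth_on (dom i `&` U) (fun x => psi i x a 0)) /\
  (forall i j x, U x -> dom i x -> dom j x ->
     psi i x = spin_action (lift S i j x) *m psi j x).

(* [g (nabla_v e1, e2)] *)
Definition connection_form (i : chart M) (x : M) (v : 'rV[R]_2) : R :=
  bil (metric M i x) (cov (@idfun M) i i (e1 S i) x v) (e2 S i x).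

(* [nabla_v psi = v(psi) + 1/4 sum_ab g(nabla_v e_a, e_b) e_a e_b psi] *)
Definition spin_nabla (psi : spinor) (i : chart M) (x : M) (v : 'rV[R]_2)
    : 'cV[R[i]]_2 :=
  \col_a cdif i (fun y => psi i y a 0) x v
  + (2^-1 * connection_form i x v)%:C%C *: (omega R *m psi i x).

Definition dirac (psi : spinor) : spinor := fun i x =>
  E1 R *m spin_nabla psi i x (e1 S i x) + E2 R *m spin_nabla psi i x (e2 S i x).

(* [D + a + b omega] *)
Definition scalar_chiral (a b : M -> R[i]) (psi : spinor) : spinor :=
  fun i x => dirac psi i x + a x *: psi i x + b x *: (omega R *m psi i x).

End Dirac.

Section Factorization.
Variables (R : realType) (c : R) (eta : R[i]).
Variables (M : riemannian R 2) (S : spin_structure M) (N : riemannian R 3).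
Variables (phi : M -> N) (xi : unit_normal phi) (A : shape_operator xi).

Local Notation H := (mean_curvature A).

Definition Bop (psi : spinor M) : spinor M := fun i x =>
  dirac S (dirac S psi) i x
  + (2 * eta) *: (omega R *m dirac S psi i x)
  - (2 * eta * (H x)%:C%C) *: (omega R *m psi i x)
  + (norm2_shape A x - H x ^+ 2 - 2 * c)%:C%C *: psi i x.

Definition factorization (U : set M) (a b p q : M -> R[i]) : Prop :=
  [/\ csmooth_on U a, csmooth_on U b, csmooth_on U p, csmooth_on U q &
    forall psi : spinor M, spinor_field S U psi ->
      forall i x, U x -> dom i x ->
        Bop psi i x = scalar_chiral S a b (scalar_chiral S p q psi) i x].

End Factorization.

(* Main.v *)
(** Since [D (f psi) = grad f . psi + f D psi] and [D omega = - omega D], the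
    composition [(D + a + b omega) (D + p + q omega)] equals
      [D^2 + (a + p) D + (b - q) omega D + (grad p + (grad q) omega)
       + (a p - b q) + (a q + b p) omega].
    Testing against spinors that vanish at a point, and whose first derivative
    there is arbitrary, gives [p = - a] and [b = q + 2 eta]; testing against
    arbitrary values then separates the odd part [grad p + (grad q) omega = 0]
    and the two even parts, one of which reads [2 eta (H - a) = 0], where
    [eta <> 0].  The immersion enters only through the smoothness of [H]. *)
Require Import Defs.
From HB Require Import structures.
From mathcomp Require Import all_boot all_order all_algebra.
From mathcomp Require Import complex.
From mathcomp Require Import all_classical all_reals all_analysis.
From mathcomp Require Import ring.

Set Implicit Arguments.
Unset Strict Implicit.
Unset Printing Implicit Defensive.
Import Order.TTheory GRing.Theory Num.Theory.
Import numFieldNormedType.Exports.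
(* [vector] and [fintype] shadow [coord] and [lift]. *)
Import Defs.
Local Open Scope classical_set_scope.
Local Open Scope ring_scope.

(** * Differential calculus on normed spaces *)

(** The factorization identity is available only on spinor fields defined over all of [U], in every
    spin frame at once. A test spinor prescribed at one point must therefore be cut off inside a
    chart, carried to the other frames by the lift cocycle and extended by zero. The extension is
    smooth because its support is closed in the whole manifold, and this is where the Hausdorff
    axiom enters. [Ck] differentiates along one constant vector at a time. Linearity in the
    direction and the chain rule, needed for varying frames and for chart changes, are recovered
    from continuity of the partial derivatives. With [p = - H] and [q = beta], the odd condition is
    the Cauchy-Riemann pair [dbeta(e1) = - dH(e2)], [dbeta(e2) = dH(e1)], that is
    [grad beta = J grad H]. In the scalar even condition the square of [H] cancels against the one
    in the zero-order coefficient; the [omega] part then holds identically. *)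

Lemma open_eq_near (T : topologicalType) (T' : Type) (U : set T)
    (f g : T -> T') (x : T) :
  open U -> U x -> {in U, f =1 g} -> \near x, f x = g x.
Proof.
move=> oU Ux fg; have := open_nbhs_nbhs (conj oU Ux).
by apply: filterS => y Uy; apply: fg; rewrite inE.
Qed.

Section DirectionalDerivative.
Variables (R : realType) (V W : normedModType R).
Implicit Types (f g : V -> W) (x v : V).

Lemma is_derive_line f x v (t : R) :
  derivable f (t *: v + x) v ->
  is_derive t 1 (fun s : R => f (s *: v + x)) ('D_v f (t *: v + x)).
Proof.
move=> df.
have E : (fun h : R => h^-1 *: (((fun s : R => f (s *: v + x)) \o shift t)
      (h *: 1) - f (t *: v + x))) =
    (fun h => h^-1 *: ((f \o shift (t *: v + x)) (h *: v) - f (t *: v + x))).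
  apply/funext => h /=; congr (_ *: (f _ - _)).
  by rewrite [_ *: 1]mulr1 scalerDl addrA.
by split; rewrite /derivable /derive E.
Qed.

(** Homogeneity in the direction needs no differentiability: replace [h] by [k * h] in the
    difference quotient. *)
Lemma is_deriveZv f x v (k : R) :
  derivable f x v -> is_derive x (k *: v) f (k *: 'D_v f x).
Proof.
move=> df.
have [->|k0] := eqVneq k 0; first by rewrite !scale0r; exact: is_derive0.
have E : (fun h : R => h^-1 *: ((f \o shift x) (h *: (k *: v)) - f x)) =
   (fun h => k *: ((fun h => h^-1 *: ((f \o shift x) (h *: v) - f x)) (k * h))).
  apply/funext => h /=; rewrite !scalerA [h * k]mulrC.
  (* At [h = 0] both sides agree because the increment of [f] is zero. *)
  have [->|h0] := eqVneq h 0.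
    by rewrite mulr0 !scale0r add0r subrr !scaler0.
  by rewrite invfM mulrA divff // mul1r.
have C : (fun h : R => k *:
      ((fun h => h^-1 *: ((f \o shift x) (h *: v) - f x)) (k * h))) h
    @[h --> 0^'] --> k *: 'D_v f x.
  apply: cvgZl_tmp.
  have kh : k * h @[h --> 0^'] --> (0:R)^'.
    move=> A [e /= e0 eA]; exists (e / `|k|) => /=;
      first by rewrite divr_gt0 // normr_gt0.
    move=> h /=; rewrite sub0r normrN ltr_pdivlMr ?normr_gt0 // => hk h0.
    by apply: eA; rewrite /= ?sub0r ?normrN ?normrM 1?mulrC // mulf_neq0.
  exact: (cvg_comp _ _ kh df).
split; first by apply/cvg_ex; exists (k *: 'D_v f x); rewrite E.
by rewrite /derive E; apply: cvg_lim.
Qed.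

End DirectionalDerivative.

Lemma MVT_direction (R : realType) (V : normedModType R) (f : V -> R)
    (x v : V) :
  (forall t : R, 0 <= t <= 1 -> derivable f (t *: v + x) v) ->
  exists2 t : R, 0 <= t <= 1 & f (v + x) - f x = 'D_v f (t *: v + x).
Proof.
move=> df.
have d (t : R) : 0 <= t <= 1 ->
    is_derive t 1 (fun s : R => f (s *: v + x) : R) ('D_v f (t *: v + x)).
  by move=> /df; exact: is_derive_line.
have [||t] := @MVT_segment R (fun s => f (s *: v + x))
  (fun s => 'D_v f (s *: v + x)) 0 1 ler01.
- move=> t; rewrite in_itv /= => /andP[t0 t1]; apply: d; apply/andP;
  by split; exact: ltW.
- by apply: derivable_within_continuous => t; rewrite in_itv /= => /d [].
rewrite in_itv /= scale1r scale0r add0r subr0 mulr1 => t01 E; by exists t.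
Qed.

Lemma rV_norm_le (R : realType) n (v : 'rV[R]_n) (e : R) : 0 <= e ->
  (forall j, `|v 0 j| <= e) -> `|v| <= e.
Proof.
move=> e0 ve; rewrite [leLHS]/Num.Def.normr/= mx_normrE.
rewrite (bigmax_le _ e0) //= => -[i j] _ /=.
by rewrite ord1.
Qed.

Lemma rV_norm_ge (R : realType) n (v : 'rV[R]_n) j : `|v 0 j| <= `|v|.
Proof.
rewrite [leRHS]/Num.Def.normr/= mx_normrE.
exact: (le_bigmax _ (fun i : 'I_1 * 'I_n => `|v i.1 i.2|) (0, j)).
Qed.

Lemma is_diff_littleo (R : realType) (V W : normedModType R) (f : V -> W)
    (df : {linear V -> W}) (x : V) :
  continuous df -> f \o shift x = cst (f x) + df +o_ 0 id ->
  differentiable f x /\ forall v, 'D_v f x = df v.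
Proof.
move=> cdf H; have E := diff_unique cdf H.
have df' : differentiable f x by apply/diff_locallyP; rewrite E.
by split => // v; rewrite deriveE // E.
Qed.

(* Total differential: walk from [x] to [x + h] along the coordinate axes and
   apply the mean value theorem on each leg. *)
Lemma continuous_partials_differentiable (R : realType) n (f : 'rV[R]_n -> R)
    (x : 'rV[R]_n) :
  (forall k, \near x, derivable f x (delta_mx 0 k)) ->
  (forall k, {for x, continuous ('D_(delta_mx 0 k) f)}) ->
  differentiable f x /\
  forall v, 'D_v f x = \sum_k v 0 k * 'D_(delta_mx 0 k) f x.
Proof.
move=> df cf.
pose d (h : 'rV[R]_n) : R := \sum_k h 0 k * 'D_(delta_mx 0 k) f x.
have ld : linear d.
  move=> a u v; rewrite /d scaler_sumr -big_split /=; apply: eq_bigr => k _.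
  by rewrite !mxE mulrDl -mulrA.
pose dM := GRing.isLinear.Build _ _ _ _ _ ld.
pose dL : {linear 'rV[R]_n -> R} := HB.pack d dM.
have cd : continuous d.
  apply: (continuous_big (op := +%R)); first exact: add_continuous.
  by move=> k _ y; apply: (continuousM
    (@matrix_normedtype.coord_continuous R 1 n 0 k y)); exact: cst_continuous.
apply: (@is_diff_littleo R 'rV[R]_n R f dL x cd).
  apply/eqaddoP => _/posnumP[e].
  (* Dividing by [n.+1] rather than [n] keeps the bound positive when [n = 0]; the [n] legs together
     still contribute at most [e * |h|]. *)
  have [r /= r0 rP] : exists2 r : R, 0 < r & forall y, `|x - y| < r -> forall k,
     derivable f y (delta_mx 0 k) /\
     `|'D_(delta_mx 0 k) f x - 'D_(delta_mx 0 k) f y| <= e%:num / n.+1%:R.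
    have near_k k : nbhs x (fun y => derivable f y (delta_mx 0 k) /\
       `|'D_(delta_mx 0 k) f x - 'D_(delta_mx 0 k) f y| <= e%:num / n.+1%:R).
      apply: filterI; first exact: df.
      have /cvgrPdist_le := cf k; apply; by rewrite divr_gt0.
    have [r /= r0 rP] := (nbhs_ballP x _).1 (filter_forall _ near_k).
    exists r => // y xy; apply: rP.
    by rewrite -ball_normE.
  apply/nbhs_ballP; exists r => //= h;
    rewrite -ball_normE /= sub0r normrN => hr.
  rewrite /= !fctE /=.
  (* The corners of the path: [p k] keeps the first [k] coordinates of [h] and replaces the others
     by zero. *)
  pose p (k : nat) : 'rV[R]_n := \row_j (if (j < k)%N then h 0 j else 0).
  have p0 : p 0%N = 0 by apply/rowP => j; rewrite !mxE.
  have pn : p n = h by apply/rowP => j; rewrite !mxE ltn_ord.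
  have -> : f (h + x) - (f x + d h) =
     \sum_(k < n) (f (p k.+1 + x) - f (p k + x)
                   - h 0 k * 'D_(delta_mx 0 k) f x).
    rewrite big_split /= sumrN opprD addrA; congr (_ - _).
    rewrite -(big_mkord xpredT (fun k => f (p k.+1 + x) - f (p k + x))).
    by rewrite telescope_sumr // pn p0 add0r.
  apply: (le_trans (ler_norm_sum _ _ _)).
  apply: (@le_trans _ _ (\sum_(k < n) (e%:num / n.+1%:R * `|h|))); last first.
    rewrite sumr_const card_ord -[leLHS]mulr_natr mulrAC ler_wpM2r //
      -mulrA ger_pMr //.
    by rewrite ler_pdivrMl // mulr1 ler_nat.
  apply: ler_sum => k _.
  have pS : p k.+1 = h 0 k *: delta_mx 0 k + p k.
    apply/rowP => j; rewrite !mxE eqxx /= ltnS leq_eqVlt.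
    have [->|jk] := eqVneq j k; first by rewrite eqxx ltnn mulr1 addr0.
    by rewrite -val_eqE in jk; rewrite (negbTE jk) /= mulr0 add0r.
  (* Every coordinate of the displacement from [x] is zero, a coordinate of [h], or [t] times one,
     so its sup norm is at most [|h|]. *)
  have near_p t : 0 <= t <= 1 ->
      `|x - (t *: (h 0 k *: delta_mx 0 k) + (p k + x))| < r.
    move=> /andP[t0 t1]; apply: le_lt_trans hr.
    rewrite (addrC (p k)) addrA opprD addrA opprD [- _ - x]addrC addNKr
      -opprD normrN.
    apply: rV_norm_le => // j; rewrite !mxE eqxx /=.
    have [->|jk] := eqVneq j k.
      rewrite ltnn mulr1 addr0 normrM ger0_norm //.
      by rewrite (le_trans _ (rV_norm_ge h k)) // ler_piMl.
    rewrite !mulr0 add0r; case: ifP => _; first exact: rV_norm_ge.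
    by rewrite normr0.
  rewrite pS -(addrA (h 0 k *: _)).
  have [|t t01 ->] := @MVT_direction R _ f (p k + x) (h 0 k *: delta_mx 0 k).
    by move=> t /near_p/rP/(_ k)[dft _]; have [] := is_deriveZv (h 0 k) dft.
  have /near_p/rP/(_ k)[dft ct] := t01.
  have [_ ->] := is_deriveZv (h 0 k) dft.
  rewrite -mulrBr normrM mulrC ler_pM ?normr_ge0 //; last exact: rV_norm_ge.
  by rewrite distrC.
Qed.

(** * Closure properties of k times continuously differentiable maps *)

Section Ck_general.
Variables (R : realType) (V W : normedModType R).
Implicit Types (f g : V -> W) (U : set V) (k : nat).

Lemma Ck_sub k U U' f : U' `<=` U -> Ck k U f -> Ck k U' f.
Proof.
move=> sU; elim: k f => [|k IH] f /= [cf df]; split=> //.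
- by move=> x /sU/cf.
- by move=> x /sU/cf.
by move=> v; have [d1 d2] := df v; split; [move=> x /sU/d1 | exact: IH].
Qed.

Lemma Ck_local k U f :
  (forall x, U x -> exists2 U', U' x & Ck k U' f) -> Ck k U f.
Proof.
elim: k f => [|k IH] f H /=; split=> //.
- by move=> x /H[U' U'x [cf _]]; exact: cf.
- by move=> x /H[U' U'x [cf _]]; exact: cf.
move=> v; split; first by move=> x /H[U' U'x [_ /(_ v)[d _]]]; exact: d.
by apply: IH => x /H[U' U'x [_ /(_ v)[_ d]]]; exists U'.
Qed.

Lemma CkW k U f : Ck k.+1 U f -> Ck k U f.
Proof.
elim: k f => [|k IH] f [cf df]; split=> //.
by move=> v; have [d1 d2] := df v; split; [exact: d1 | exact: IH].
Qed.

(** Continuity and derivatives at a point see only a neighbourhood. The closure lemmas below rely on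
    this, because their derivative formulas hold on [U] alone. *)
Lemma Ck_eq k U f g : open U -> (forall x, U x -> f x = g x) ->
  Ck k U f -> Ck k U g.
Proof.
move=> oU; have nfg f' g' x (fg : forall x, U x -> f' x = g' x) :
    U x -> \near x, f' x = g' x :> W.
  by move=> Ux; apply: (open_eq_near oU Ux) => y; rewrite inE => /fg.
have cfg f' g' (fg : forall x, U x -> f' x = g' x) x : U x ->
    {for x, continuous f'} -> {for x, continuous (g' : V -> W)}.
  move=> Ux; rewrite /prop_for /continuous_at -(fg _ Ux); apply: cvg_trans.
  by apply: near_eq_cvg; apply: filterS (nfg _ _ _ fg Ux) => y ->.
elim: k f g => [|k IH] f g fg /= [cf df]; split=> //.
- by move=> x Ux; apply: cfg (cf _ Ux).
- by move=> x Ux; apply: cfg (cf _ Ux).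
move=> v; have [d1 d2] := df v; split.
  by move=> x Ux; apply: near_eq_derivable (d1 _ Ux); exact: nfg.
by apply: IH d2 => x Ux; apply: near_eq_derive; exact: nfg.
Qed.

Lemma Ck_cst k U (a : W) : Ck k U (cst a : V -> W).
Proof.
elim: k a => [|k IH] a; split=> //; try by move=> x _; exact: cst_continuous.
move=> v; split; first by move=> x _; exact: derivable_cst.
by rewrite (_ : 'D_v _ = cst 0) //; apply/funext => x; rewrite derive_cst.
Qed.

Lemma CkD k U f g : open U -> Ck k U f -> Ck k U g -> Ck k U (f + g).
Proof.
move=> oU; elim: k f g => [|k IH] f g /= [cf df] [cg dg]; split=> //.
- by move=> x Ux; apply: continuousD; [exact: cf|exact: cg].
- by move=> x Ux; apply: continuousD; [exact: cf|exact: cg].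
move=> v; have [d1 d2] := df v; have [e1 e2] := dg v; split.
  by move=> x Ux; apply: derivableD; [exact: d1|exact: e1].
apply: Ck_eq (IH _ _ d2 e2) => // x Ux.
by rewrite deriveD //; [exact: d1|exact: e1].
Qed.

Lemma Ck_sum (I : Type) (r : seq I) (P : pred I) k U (F : I -> V -> W) :
  open U -> (forall i, P i -> Ck k U (F i)) ->
  Ck k U (fun x => \sum_(i <- r | P i) F i x).
Proof.
move=> oU HF; rewrite -fct_sumE; elim/big_rec: _ => [|i f Pi Cf];
  first exact: Ck_cst.
by apply: CkD => //; exact: HF.
Qed.

End Ck_general.

Section Ck_scalar.
Variables (R : realType) (V : normedModType R).
Implicit Types (f g : V -> R) (U : set V) (k : nat).

Lemma CkM k U f g : open U -> Ck k U f -> Ck k U g -> Ck k U (f * g).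
Proof.
move=> oU; elim: k f g => [|k IH] f g Hf Hg;
  move: (Hf) (Hg) => [cf df] [cg dg]; split=> //.
- by move=> x Ux; apply: continuousM; [exact: cf|exact: cg].
- by move=> x Ux; apply: continuousM; [exact: cf|exact: cg].
move=> v; have [d1 d2] := df v; have [e1 e2] := dg v; split.
  by move=> x Ux; apply: derivableM; [exact: d1|exact: e1].
have := CkD oU (IH _ _ (CkW Hf) e2) (IH _ _ (CkW Hg) d2).
by apply: Ck_eq => // x Ux; rewrite deriveM //; [exact: d1|exact: e1].
Qed.

Lemma CkN k U f : open U -> Ck k U f -> Ck k U (- f).
Proof.
move=> oU Hf; have := CkM oU (@Ck_cst R V R k U (-1)) Hf.
by apply: Ck_eq => // x Ux; rewrite /= !fctE mulN1r.
Qed.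

Lemma Ck_prod (I : Type) (r : seq I) (P : pred I) k U (F : I -> V -> R) :
  open U -> (forall i, P i -> Ck k U (F i)) ->
  Ck k U (fun x => \prod_(i <- r | P i) F i x).
Proof.
move=> oU HF; rewrite -fct_prodE; elim/big_rec: _ => [|i f Pi Cf];
  first exact: Ck_cst.
by apply: CkM => //; exact: HF.
Qed.

(** The derivative of the inverse contains the inverse only undifferentiated, so the induction
    hypothesis, one order lower, suffices. *)
Lemma CkV k U f : open U -> (forall x, U x -> f x != 0) ->
  Ck k U f -> Ck k U (fun x => (f x)^-1).
Proof.
move=> oU f0; elim: k => [|k IH] Hf; move: (Hf) => [cf df]; split=> //.
- by move=> x Ux; apply: continuousV; [exact: f0|exact: cf].
- by move=> x Ux; apply: continuousV; [exact: f0|exact: cf].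
move=> v; have [d1 d2] := df v; split.
  by move=> x Ux; apply: derivableV; [exact: f0|exact: d1].
have Hi := IH (CkW Hf).
have := CkN oU (CkM oU (CkM oU Hi Hi) d2).
apply: Ck_eq => // x Ux; rewrite deriveV //; [|exact: f0|exact: d1].
by rewrite !fctE expr2 invfM -mulNr.
Qed.

End Ck_scalar.

Section Ck_matrix.
Variables (R : realType) (V : normedModType R) (m n : nat).

Lemma Ck_mx k (U : set V) (F : V -> 'M[R]_(m, n)) i j : open U ->
  Ck k U F -> Ck k U (fun x => F x i j).
Proof.
move=> oU; elim: k F => [|k IH] F [cF dF]; split=> //.
- move=> x Ux.
  apply: (@continuous_comp _ _ _ F (fun A : 'M[R]_(m, n) => A i j)).
    exact: cF.
  exact: matrix_normedtype.coord_continuous.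
- move=> x Ux.
  apply: (@continuous_comp _ _ _ F (fun A : 'M[R]_(m, n) => A i j)).
    exact: cF.
  exact: matrix_normedtype.coord_continuous.
move=> v; have [d1 d2] := dF v; split.
  by move=> x Ux; apply: (derivable_mxP F x v).1; exact: d1.
by apply: Ck_eq (IH _ d2) => // x Ux; rewrite derive_mx ?mxE //; exact: d1.
Qed.

End Ck_matrix.

Section Ck_rV.
Variables (R : realType) (n : nat).
Implicit Types (f g : 'rV[R]_n -> R) (U : set 'rV[R]_n).

(** The source of linearity in the direction, which [Ck] does not include. *)
Lemma Ck1_differentiable U f x : open U -> Ck 1 U f -> U x ->
  differentiable f x /\
  forall v, 'D_v f x = \sum_k v 0 k * 'D_(delta_mx 0 k) f x.
Proof.
move=> oU [cf df] Ux; apply: continuous_partials_differentiable => k.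
  have := open_nbhs_nbhs (conj oU Ux); apply: filterS => y Uy.
  by have [d1 _] := df (delta_mx 0 k); exact: d1.
by have [_ [d1 _]] := df (delta_mx 0 k); exact: d1.
Qed.

Lemma Ck_coord k U i : Ck k U (fun x : 'rV[R]_n => x 0 i).
Proof.
have dv v x : is_derive x v (fun x : 'rV[R]_n => x 0 i : R) (v 0 i).
  split; first by apply: (derivable_mxP id x v).1; exact: derivable_id.
  have := derive_mx (@derivable_id R _ x v);
    rewrite derive_id => /rowP/(_ i) ->.
  by rewrite mxE.
case: k => [|k]; split=> //; try by move=> x _;
  exact: matrix_normedtype.coord_continuous.
move=> v; split; first by move=> x _; have [] := dv v x.
rewrite (_ : 'D_v _ = cst (v 0 i)); first exact: Ck_cst.
by apply/funext => x; have [_ ->] := dv v x.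
Qed.

(** Frame vectors vary with the point, whereas [Ck] uses constant directions; expanding [e x] in the
    standard basis bridges the two. *)
Lemma Ck_direction k U f (e : 'rV[R]_n -> 'rV[R]_n) : open U ->
  Ck k.+1 U f -> (forall i, Ck k U (fun x => e x 0 i)) ->
  Ck k U (fun x => 'D_(e x) f x).
Proof.
move=> oU Hf He.
have : Ck k U (fun x => \sum_i e x 0 i * 'D_(delta_mx 0 i) f x).
  apply: Ck_sum => // i _; apply: CkM => //.
  by have [_ /(_ (delta_mx 0 i))[]] := Hf.
apply: Ck_eq => // x Ux.
have Hf1 : Ck 1 U f by elim: k Hf {He} => // k IH /CkW.
by have [_ ->] := Ck1_differentiable oU Hf1 Ux.
Qed.

End Ck_rV.

(** * The chain rule *)

Section Ck_composition.
Variables (R : realType) (V : normedModType R) (n : nat).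

(** Since [F] is only derivable along [v], the ordinary chain rule is applied to its restriction to
    the line through [x] in that direction. *)
Lemma derive_comp_differentiable (W Z : normedModType R) (g : W -> Z)
    (F : V -> W) x v :
  differentiable g (F x) -> derivable F x v ->
  is_derive x v (g \o F) ('D_('D_v F x) g (F x)).
Proof.
move=> dg /derivable1P/derivable1_diffP dF.
have F0 : F (0 *: v + x) = F x by rewrite scale0r add0r.
have dgF : differentiable (g \o (fun h : R => F (h *: v + x))) 0.
  by apply: differentiable_comp => //=; rewrite F0.
have E (W' : normedModType R) (G : V -> W') :
    'D_v G x = 'D_1 (fun h : R => G (h *: v + x)) 0.
  rewrite /derive; set g1 := fun h => h^-1 *: _; set g2 := fun h => h^-1 *: _.
  suff -> : g1 = g2 by []; apply/funext => h; rewrite /g1 /g2 /=.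
  by rewrite addr0 scale0r add0r [h *: 1]mulr1.
split; first by apply/derivable1P/derivable1_diffP.
rewrite E deriveE //.
rewrite (diff_comp (f := fun h : R => F (h *: v + x)) (g := g)) //.
  by rewrite /= F0 E !deriveE.
by rewrite F0.
Qed.

Lemma Ck_comp k (U : set V) (W : set 'rV[R]_n) (g : 'rV[R]_n -> R)
    (F : V -> 'rV[R]_n) :
  open U -> open W -> (forall x, U x -> W (F x)) ->
  Ck k U F -> Ck k W g -> Ck k U (g \o F).
Proof.
move=> oU oW UW; elim: k g => [|k IH] g HF Hg;
  move: (HF) (Hg) => [cF dF] [cg dg]; split=> //.
- by move=> x Ux; apply: continuous_comp; [exact: cF | apply: cg; exact: UW].
- by move=> x Ux; apply: continuous_comp; [exact: cF | apply: cg; exact: UW].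
have Hg1 : Ck 1 W g by elim: k Hg {IH HF dF dg} => // k IH /CkW.
move=> v; have [d1 d2] := dF v.
have dgF x : U x -> is_derive x v (g \o F) ('D_('D_v F x) g (F x)).
  move=> Ux; apply: derive_comp_differentiable; last exact: d1.
  by have [] := Ck1_differentiable oW Hg1 (UW _ Ux).
split; first by move=> x /dgF[].
have : Ck k U (fun x => \sum_i 'D_v F x 0 i * ('D_(delta_mx 0 i) g \o F) x).
  apply: Ck_sum => // i _; apply: CkM => //; first exact: Ck_mx.
  by apply: IH; [exact: CkW | have [] := dg (delta_mx 0 i)].
apply: Ck_eq => // x Ux; have [_ ->] := dgF _ Ux.
by have [_ ->] := Ck1_differentiable oW Hg1 (UW _ Ux).
Qed.

End Ck_composition.

(** * Bump functions *)

Section FlatFunction.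
Variable R : realType.
Implicit Types (n : nat) (t : R).

Definition flat n t : R := if 0 < t then t^-1 ^+ n * expR (- t^-1) else 0.

Lemma flat_ge0 n t : 0 <= flat n t.
Proof.
rewrite /flat; case: ifP => // t0.
by rewrite mulr_ge0 ?expR_ge0 // exprn_ge0 // invr_ge0 ltW.
Qed.

(** The exponential series dominates its term of degree [n.+2], evaluated at [t^-1]. Two spare
    powers of [t] remain, enough for a zero derivative at the origin. *)
Lemma flat_le_sqr n t : flat n t <= n.+2`!%:R * t ^+ 2.
Proof.
rewrite /flat; case: ifP => t0; last by rewrite mulr_ge0 ?sqr_ge0.
rewrite expRN ler_pdivrMr ?expR_gt0 //.
have le_exp : t^-1 ^+ n.+2 <= n.+2`!%:R * expR t^-1.
  rewrite mulrC -ler_pdivrMr ?ltr0n ?fact_gt0 //.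
  have t10 : 0 <= t^-1 by rewrite invr_ge0 ltW.
  by apply: le_trans (expR_ge1Dxn n.+1 t10); rewrite lerDr.
rewrite mulrAC; apply: le_trans (ler_wpM2r (sqr_ge0 t) le_exp).
by rewrite -addn2 exprD -mulrA -exprMn mulVf ?gt_eqF // expr1n mulr1.
Qed.

(* The family [flat n] spans a space stable under differentiation, so that its
   members are smooth by a single induction. *)
Lemma is_derive_flat n t :
  is_derive t 1 (flat n) (flat n.+2 t - n%:R * flat n.+1 t).
Proof.
have [t0|t0|<-] := ltgtP 0 t.
- pose g := fun s : R => s^-1 ^+ n * expR (- s^-1).
  have gE : \near t, g t = flat n t.
    by near=> s; rewrite /flat /g ifT //; near: s; exact: lt_nbhsr.
  apply: near_eq_is_derive gE _.
  have tn0 : t != 0 by rewrite gt_eqF.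
  have dw : is_derive t 1 (fun s : R => s^-1) (- t^-1 ^+ 2).
    have di := @derivable_id R R t 1.
    have [] : derivable (fun s : R => s^-1) t 1 /\
        'D_1 (fun s : R => s^-1) t = - t ^- 2 *: 'D_1 id t.
      by split; [exact: (derivableV (f := id)) | exact: (deriveV (f := id))].
    by move=> d1 d2; split=> //; rewrite d2 derive_id exprVn [_ *: _]mulr1.
  have de : is_derive t 1 (fun s : R => expR (- s^-1))
      (expR (- t^-1) * (t^-1 ^+ 2)).
    have H := @is_derive1_comp R expR (fun s : R => - s^-1) t _ _
      (is_derive_expR _) (is_deriveN dw).
    by apply: (is_derive_eq H); rewrite /= opprK.
  have -> : g = (fun s : R => s^-1) ^+ n * (fun s : R => expR (- s^-1)).
    by apply/funext => s; rewrite /g fctE exprfctE.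
  rewrite {g}.
  apply: (is_derive_eq (is_deriveM (is_deriveX n dw) de)).
  rewrite /flat t0 /= !fctE.
  case: n => [|n].
    rewrite !expr0 !mul0r scale0r scaler0 subr0 addr0.
    by rewrite [_ *: _]mulrA mul1r mulrC.
  rewrite /GRing.scale /= !(exprSr _ n.+2) !(exprSr _ n.+1) !(exprSr _ n).
  by move: (t^-1 ^+ n) (n.+1%:R : R) (expR _) => X m e; ring.
- have gE : \near t, cst 0 t = flat n t.
    near=> s; rewrite /flat ifF //; apply/negbTE; rewrite -leNgt ltW //.
    by near: s; exact: lt_nbhsl.
  apply: near_eq_is_derive gE _.
  by rewrite /flat ltNge (ltW t0) /= mulr0 subrr; exact: is_derive_cst.
(* At the origin neither branch describes a neighbourhood. The claimed derivative is zero there, and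
   the quadratic bound makes the difference quotient at most a constant times [|h|]. *)
have -> : flat n.+2 0 - n%:R * flat n.+1 0 = 0 :> R.
  by rewrite /flat ltxx mulr0 subrr.
have f0 : flat n 0 = 0 by rewrite /flat ltxx.
suff C : (fun h : R => h^-1 *: ((flat n \o shift 0) (h *: 1) - flat n 0))
    @ 0^' --> (0:R).
  by split; [apply/cvg_ex; exists 0 | apply: cvg_lim].
have Cgt0 : (0:R) < n.+2`!%:R by rewrite ltr0n fact_gt0.
apply/cvgrPdist_le => e e0; exists (e / n.+2`!%:R) => /=;
  first by rewrite divr_gt0.
move=> h; rewrite /= sub0r normrN sub0r normrN => hr h0.
rewrite f0 subr0 addr0 [h *: 1]mulr1 normrM normfV ger0_norm ?flat_ge0 //.
rewrite ler_pdivrMl ?normr_gt0 //; apply: le_trans (flat_le_sqr _ _) _.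
rewrite -real_normK ?num_real // expr2 mulrA mulrC ler_wpM2l //.
by rewrite mulrC -ler_pdivlMr // ltW.
Unshelve. all: by end_near. Qed.

End FlatFunction.

(** The induction on [k] is uniform in [n], because one derivative of [flat n] produces [flat n.+1]
    and [flat n.+2]. *)
Lemma Ck_flat (R : realType) (V : normedModType R) n k (U : set V)
    (r : V -> R) :
  open U -> Ck k U r -> Ck k U (flat n \o r).
Proof.
move=> oU; elim: k n => [|k IH] n Hr; move: (Hr) => [cr dr].
  split=> // x Ux; apply: continuous_comp; first exact: cr.
  apply/differentiable_continuous/derivable1_diffP.
  by have [] := is_derive_flat n (r x).
split.
  move=> x Ux; apply: continuous_comp; first exact: cr.
  apply/differentiable_continuous/derivable1_diffP.
  by have [] := is_derive_flat n (r x).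
move=> v; have [d1 d2] := dr v.
have dfr x : U x -> is_derive x v (flat n \o r)
    ('D_v r x * (flat n.+2 (r x) - n%:R * flat n.+1 (r x))).
  move=> Ux; have [df <-] := is_derive_flat n (r x).
  have := derive_comp_differentiable ((derivable1_diffP _ _).1 df) (d1 _ Ux).
  move=> [d3 E]; split=> //; rewrite E.
  by have [_] := is_deriveZv ('D_v r x) df; rewrite [_ *: 1]mulr1.
split; first by move=> x /dfr[].
have := CkM oU d2 (CkD oU (IH n.+2 (CkW Hr))
  (CkM oU (@Ck_cst R V R k U (- n%:R)) (IH n.+1 (CkW Hr)))).
by apply: Ck_eq => // x Ux; have [_ ->] := dfr _ Ux; rewrite !fctE /= mulNr.
Qed.

(** * Smooth functions in a chart *)

Section ChartCalculus.
Variables (R : realType) (n : nat) (M : manifold R n).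
Implicit Types (i : chart M) (U : set M) (f g : M -> R).

Lemma image_chartP i U y :
  (coord i @` (dom i `&` U)) y ->
  [/\ dom i (point i y), U (point i y) & coord i (point i y) = y].
Proof. by move=> [x [dx Ux] <-]; rewrite coordK. Qed.

Lemma open_image_chart i U : open U -> open (coord i @` (dom i `&` U)).
Proof.
move=> oU.
have -> : coord i @` (dom i `&` U) = coord i @` dom i `&` point i @^-1` U.
  rewrite eqEsubset; split => y.
    by move=> yD; have [dy Uy yE] := image_chartP yD; split=> //;
      exists (point i y).
  by move=> [[x dx <-]] /=; rewrite coordK // => Ux; exists x.
rewrite openE => y [yD yU]; apply: filterI.
  exact: (open_nbhs_nbhs (conj (@coord_open _ _ _ i) yD)).
by apply: (point_continuous yD); exact: open_nbhs_nbhs.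
Qed.

(** One chart of [smooth_on]. The set [U] may itself lie in the domain of another chart, as happens
    for frame transitions. *)
Definition chart_smooth i U f :=
  Cinfty (coord i @` (dom i `&` U)) (f \o point i).

Lemma chart_smooth_sub i U U' f : dom i `&` U' `<=` U ->
  chart_smooth i U f -> chart_smooth i U' f.
Proof.
move=> sU Hf k; apply: Ck_sub (Hf k) => _ [x [dx Ux] <-].
by exists x => //; split=> //; exact: sU.
Qed.

Lemma chart_smooth_eq i U f g : open U ->
  (forall x, dom i x -> U x -> f x = g x) ->
  chart_smooth i U f -> chart_smooth i U g.
Proof.
move=> oU fg Hf k; apply: Ck_eq (Hf k); first exact: open_image_chart.
by move=> y /image_chartP[dy Uy _]; exact: fg.
Qed.

Lemma chart_smooth_local i U f :
  (forall x, U x -> dom i x -> exists2 U', U' x & chart_smooth i U' f) ->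
  chart_smooth i U f.
Proof.
move=> Hf k; apply: Ck_local => y yU; have [dy Uy <-] := image_chartP yU.
have [U' U'y HU'] := Hf _ Uy dy; exists (coord i @` (dom i `&` U')).
  by exists (point i y).
exact: HU'.
Qed.

Lemma chart_smooth_cst i U (a : R) : chart_smooth i U (fun=> a).
Proof. by move=> k; exact: Ck_cst. Qed.

Lemma chart_smoothD i U f g : open U -> chart_smooth i U f ->
  chart_smooth i U g -> chart_smooth i U (fun x => f x + g x).
Proof.
by move=> oU Hf Hg k; apply: CkD (Hf k) (Hg k); exact: open_image_chart.
Qed.

Lemma chart_smoothN i U f : open U -> chart_smooth i U f ->
  chart_smooth i U (fun x => - f x).
Proof. by move=> oU Hf k; apply: CkN (Hf k); exact: open_image_chart. Qed.

Lemma chart_smoothB i U f g : open U -> chart_smooth i U f ->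
  chart_smooth i U g -> chart_smooth i U (fun x => f x - g x).
Proof.
by move=> oU Hf Hg; apply: chart_smoothD => //; exact: chart_smoothN.
Qed.

Lemma chart_smoothM i U f g : open U -> chart_smooth i U f ->
  chart_smooth i U g -> chart_smooth i U (fun x => f x * g x).
Proof.
by move=> oU Hf Hg k; apply: CkM (Hf k) (Hg k); exact: open_image_chart.
Qed.

Lemma chart_smooth_sum (I : Type) (r : seq I) (P : pred I) i U
    (F : I -> M -> R) :
  open U -> (forall j, P j -> chart_smooth i U (F j)) ->
  chart_smooth i U (fun x => \sum_(j <- r | P j) F j x).
Proof.
move=> oU HF k; apply: (@Ck_sum R _ R I r P k _ (fun j => F j \o point i)).
  exact: open_image_chart.
by move=> j Pj; exact: HF.
Qed.

Lemma chart_smooth_prod (I : Type) (r : seq I) (P : pred I) i U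
    (F : I -> M -> R) :
  open U -> (forall j, P j -> chart_smooth i U (F j)) ->
  chart_smooth i U (fun x => \prod_(j <- r | P j) F j x).
Proof.
move=> oU HF k; apply: (@Ck_prod R _ I r P k _ (fun j => F j \o point i)).
  exact: open_image_chart.
by move=> j Pj; exact: HF.
Qed.

Lemma chart_smoothV i U f : open U ->
  (forall x, dom i x -> U x -> f x != 0) ->
  chart_smooth i U f -> chart_smooth i U (fun x => (f x)^-1).
Proof.
move=> oU f0 Hf k; apply: (CkV _ _ (Hf k)); first exact: open_image_chart.
by move=> y /image_chartP[dy Uy _]; exact: f0.
Qed.

Lemma chart_smooth_derivable i U f x v : chart_smooth i U f -> dom i x -> U x ->
  derivable (f \o point i) (coord i x) v.
Proof.
by move=> /(_ 1%N)[_ /(_ v)[df _]] dx Ux; apply: df; exists x.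
Qed.

Lemma dif_linear i U f x v : open U -> chart_smooth i U f -> dom i x -> U x ->
  dif i f x v = \sum_k v 0 k * dif i f x (delta_mx 0 k).
Proof.
move=> oU Hf dx Ux.
have xU : (coord i @` (dom i `&` U)) (coord i x) by exists x.
rewrite /dif.
by have [_ ->] := Ck1_differentiable (open_image_chart oU) (Hf 1%N) xU.
Qed.

Lemma dif_eq (W : normedModType R) i U (f g : M -> W) x v : open U ->
  (forall y, dom i y -> U y -> f y = g y) -> dom i x -> U x ->
  dif i f x v = dif i g x v.
Proof.
move=> oU fg dx Ux; apply: near_eq_derive.
have oV := open_image_chart (i := i) oU.
have xV : (coord i @` (dom i `&` U)) (coord i x) by exists x.
have := open_nbhs_nbhs (conj oV xV); apply: filterS.
by move=> y /image_chartP[dy Uy _]; exact: fg.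
Qed.

Lemma difD i U f g x v : chart_smooth i U f -> chart_smooth i U g ->
  dom i x -> U x ->
  dif i (fun y => f y + g y) x v = dif i f x v + dif i g x v.
Proof.
move=> Hf Hg dx Ux.
have E := deriveD (chart_smooth_derivable (v := v) Hf dx Ux)
  (chart_smooth_derivable (v := v) Hg dx Ux).
by rewrite /dif -E.
Qed.

Lemma difN i U f x v : chart_smooth i U f -> dom i x -> U x ->
  dif i (fun y => - f y) x v = - dif i f x v.
Proof.
move=> Hf dx Ux; have E := deriveN (chart_smooth_derivable (v := v) Hf dx Ux).
by rewrite /dif -E.
Qed.

Lemma difM i U f g x v : chart_smooth i U f -> chart_smooth i U g ->
  dom i x -> U x ->
  dif i (fun y => f y * g y) x v = dif i f x v * g x + f x * dif i g x v.
Proof.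
move=> Hf Hg dx Ux.
have := deriveM (chart_smooth_derivable (v := v) Hf dx Ux)
  (chart_smooth_derivable (v := v) Hg dx Ux).
by rewrite /= coordK // addrC [_ *: _]mulrC => E; rewrite /dif -E.
Qed.

Lemma dif_cst i (a : R) x v : dif i (fun=> a) x v = 0.
Proof. exact: derive_cst. Qed.

Definition mx_smooth i U p q (F : M -> 'M[R]_(p, q)) :=
  forall a b, chart_smooth i U (fun x => F x a b).

Lemma smooth_on_mx i U p q (F : M -> 'M[R]_(p, q)) : open U ->
  Cinfty (coord i @` (dom i `&` U)) (F \o point i) -> mx_smooth i U F.
Proof.
by move=> oU HF a b k; apply: Ck_mx (HF k); exact: open_image_chart.
Qed.

Lemma chart_smooth_dif i U f (e : M -> 'rV[R]_n) : open U ->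
  chart_smooth i U f -> mx_smooth i U e ->
  chart_smooth i U (fun x => dif i f x (e x)).
Proof.
move=> oU Hf He k; have oV := open_image_chart (i := i) oU.
apply: Ck_eq (Ck_direction oV (Hf k.+1) (fun j => He 0 j k)) => //.
by move=> y /image_chartP[_ _ yE]; rewrite /= /dif yE.
Qed.

Lemma dif_mx i U p q (F : M -> 'M[R]_(p, q)) x v a b : open U ->
  Cinfty (coord i @` (dom i `&` U)) (F \o point i) -> dom i x -> U x ->
  dif i F x v a b = dif i (fun y => F y a b) x v.
Proof.
move=> oU /(_ 1%N)[_ /(_ v)[dF _]] dx Ux.
by rewrite /dif derive_mx ?mxE //; apply: dF; exists x.
Qed.

Lemma mx_smooth_eq i U p q (F G : M -> 'M[R]_(p, q)) : open U ->
  (forall x, dom i x -> U x -> F x = G x) -> mx_smooth i U F -> mx_smooth i U G.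
Proof.
by move=> oU FG HF a b; apply: chart_smooth_eq (HF a b) => // x dx Ux;
  rewrite FG.
Qed.

Lemma mx_smooth_cst i U p q (A : 'M[R]_(p, q)) : mx_smooth i U (fun=> A).
Proof. by move=> a b; exact: chart_smooth_cst. Qed.

Lemma mx_smoothD i U p q (F G : M -> 'M[R]_(p, q)) : open U ->
  mx_smooth i U F -> mx_smooth i U G -> mx_smooth i U (fun x => F x + G x).
Proof.
move=> oU HF HG a b.
apply: chart_smooth_eq (chart_smoothD oU (HF a b) (HG a b)) => // x _ _.
by rewrite mxE.
Qed.

Lemma mx_smoothM i U p q r (F : M -> 'M[R]_(p, q)) (G : M -> 'M[R]_(q, r)) :
  open U -> mx_smooth i U F -> mx_smooth i U G ->
  mx_smooth i U (fun x => F x *m G x).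
Proof.
move=> oU HF HG a b.
have : chart_smooth i U (fun x => \sum_j F x a j * G x j b).
  by apply: chart_smooth_sum => // j _; exact: chart_smoothM.
by apply: chart_smooth_eq => // x _ _; rewrite mxE.
Qed.

Lemma mx_smooth_tr i U p q (F : M -> 'M[R]_(p, q)) : open U ->
  mx_smooth i U F -> mx_smooth i U (fun x => (F x)^T).
Proof.
by move=> oU HF a b; apply: chart_smooth_eq (HF b a) => // x _ _; rewrite mxE.
Qed.

Lemma chart_smooth_det i U p (F : M -> 'M[R]_p) : open U ->
  mx_smooth i U F -> chart_smooth i U (fun x => \det (F x)).
Proof.
move=> oU HF; apply: chart_smooth_sum => // s _; apply: chart_smoothM => //.
  exact: chart_smooth_cst.
by apply: chart_smooth_prod => // j _; exact: HF.
Qed.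

(** By Cramer's rule each entry is a signed minor divided by the determinant. This gives smooth
    Christoffel symbols, through the inverse metric. *)
Lemma mx_smooth_inv i U p (F : M -> 'M[R]_p) : open U ->
  (forall x, dom i x -> U x -> F x \in unitmx) ->
  mx_smooth i U F -> mx_smooth i U (fun x => invmx (F x)).
Proof.
move=> oU uF HF a b.
have : chart_smooth i U (fun x => (\det (F x))^-1 *
    ((-1) ^+ (b + a) * \det (row' b (col' a (F x))))).
  apply: chart_smoothM => //.
    apply: chart_smoothV => //; last exact: chart_smooth_det.
    by move=> x dx Ux; rewrite -unitfE -unitmxE uF.
  apply: chart_smoothM => //; first exact: chart_smooth_cst.
  apply: chart_smooth_det => // c d.
  apply: chart_smooth_eq (HF (fintype.lift b c) (fintype.lift a d)) => //.
  by move=> x _ _; rewrite !mxE.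
by apply: chart_smooth_eq => // x dx Ux; rewrite /invmx uF // !mxE.
Qed.

Lemma chart_smooth_bil i U (G : M -> 'M[R]_n) (u v : M -> 'rV[R]_n) : open U ->
  mx_smooth i U G -> mx_smooth i U u -> mx_smooth i U v ->
  chart_smooth i U (fun x => bil (G x) (u x) (v x)).
Proof.
move=> oU HG Hu Hv.
exact: (mx_smoothM oU (mx_smoothM oU Hu HG) (mx_smooth_tr oU Hv)).
Qed.

End ChartCalculus.

(** * Complex-valued functions in a chart *)

Section ComplexChartCalculus.
Variables (R : realType) (n : nat) (M : manifold R n).
Implicit Types (i : chart M) (U : set M) (f g : M -> R[i]).

Definition cchart_smooth i U f :=
  chart_smooth i U (fun x => complex.Re (f x)) /\
  chart_smooth i U (fun x => complex.Im (f x)).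

Lemma csmooth_onP U f : csmooth_on U f <-> forall i, cchart_smooth i U f.
Proof.
split=> [[H1 H2] i|H]; first by split; [exact: H1 | exact: H2].
by split=> i; case: (H i).
Qed.

Lemma cchart_smooth_sub i U U' f : dom i `&` U' `<=` U ->
  cchart_smooth i U f -> cchart_smooth i U' f.
Proof. by move=> sU [H1 H2]; split; exact: chart_smooth_sub sU _. Qed.

Lemma cchart_smooth_eq i U f g : open U ->
  (forall x, dom i x -> U x -> f x = g x) ->
  cchart_smooth i U f -> cchart_smooth i U g.
Proof.
move=> oU fg [H1 H2].
by split; [apply: chart_smooth_eq H1|apply: chart_smooth_eq H2] => // x dx Ux;
  rewrite fg.
Qed.

Lemma cchart_smooth_real i U (f : M -> R) :
  chart_smooth i U f -> cchart_smooth i U (fun x => (f x)%:C%C).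
Proof. by move=> Hf; split=> //; exact: chart_smooth_cst. Qed.

Lemma cchart_smooth_cst i U (a : R[i]) : cchart_smooth i U (fun=> a).
Proof. by split; exact: chart_smooth_cst. Qed.

Lemma cchart_smoothD i U f g : open U -> cchart_smooth i U f ->
  cchart_smooth i U g -> cchart_smooth i U (fun x => f x + g x).
Proof.
move=> oU [f1 f2] [g1 g2]; split.
  apply: chart_smooth_eq (chart_smoothD oU f1 g1) => // x _ _.
  by case: (f x); case: (g x).
apply: chart_smooth_eq (chart_smoothD oU f2 g2) => // x _ _.
by case: (f x); case: (g x).
Qed.

Lemma cchart_smoothM i U f g : open U -> cchart_smooth i U f ->
  cchart_smooth i U g -> cchart_smooth i U (fun x => f x * g x).
Proof.
move=> oU [f1 f2] [g1 g2]; split.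
  apply: chart_smooth_eq (chart_smoothB oU (chart_smoothM oU f1 g1)
    (chart_smoothM oU f2 g2)) => //.
  by move=> x _ _; case: (f x) => a b; case: (g x).
apply: chart_smooth_eq (chart_smoothD oU (chart_smoothM oU f1 g2)
  (chart_smoothM oU f2 g1)) => //.
by move=> x _ _; case: (f x) => a b; case: (g x).
Qed.

Lemma cchart_smoothN i U f : open U -> cchart_smooth i U f ->
  cchart_smooth i U (fun x => - f x).
Proof.
move=> oU Hf; have Hc := cchart_smooth_cst i U (-1).
apply: cchart_smooth_eq (cchart_smoothM oU Hc Hf) => // x _ _.
by rewrite mulN1r.
Qed.

Lemma cchart_smooth_sum (I : Type) (r : seq I) (P : pred I) i U
    (F : I -> M -> R[i]) :
  open U -> (forall j, P j -> cchart_smooth i U (F j)) ->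
  cchart_smooth i U (fun x => \sum_(j <- r | P j) F j x).
Proof.
move=> oU HF; elim: r => [|j r IH].
  apply: cchart_smooth_eq (cchart_smooth_cst i U 0) => // x _ _.
  by rewrite big_nil.
have [Pj|Pj] := boolP (P j).
  apply: cchart_smooth_eq (cchart_smoothD oU (HF j Pj) IH) => // x _ _.
  by rewrite big_cons Pj.
by apply: cchart_smooth_eq IH => // x _ _; rewrite big_cons (negbTE Pj).
Qed.

Lemma cchart_smooth_cdif i U f (e : M -> 'rV[R]_n) : open U ->
  cchart_smooth i U f -> mx_smooth i U e ->
  cchart_smooth i U (fun x => cdif i f x (e x)).
Proof. by move=> oU [f1 f2] He; split; exact: chart_smooth_dif. Qed.

Lemma cdifD i U f g x v : cchart_smooth i U f -> cchart_smooth i U g ->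
  dom i x -> U x ->
  cdif i (fun y => f y + g y) x v = cdif i f x v + cdif i g x v.
Proof.
move=> [f1 f2] [g1 g2] dx Ux; rewrite /cdif.
rewrite -[RHS]/(_ +i* _)%C -(difD v f1 g1 dx Ux) -(difD v f2 g2 dx Ux).
by congr (dif i _ x v +i* dif i _ x v)%C; apply/funext => y; case: (f y);
  case: (g y).
Qed.

Lemma cdifM i U f g x v : open U -> cchart_smooth i U f ->
  cchart_smooth i U g -> dom i x -> U x ->
  cdif i (fun y => f y * g y) x v = cdif i f x v * g x + f x * cdif i g x v.
Proof.
move=> oU [f1 f2] [g1 g2] dx Ux.
have fg1 := chart_smoothM oU f1 g1; have f2g2 := chart_smoothM oU f2 g2.
have fg2 := chart_smoothN oU f2g2.
have fg3 := chart_smoothM oU f1 g2; have fg4 := chart_smoothM oU f2 g1.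
rewrite /cdif.
rewrite (_ : (fun y => complex.Re (f y * g y)) =
    (fun y => complex.Re (f y) * complex.Re (g y)
              + - (complex.Im (f y) * complex.Im (g y)))); last first.
  by apply/funext => y; case: (f y) => a b; case: (g y).
rewrite (_ : (fun y => complex.Im (f y * g y)) =
    (fun y => complex.Re (f y) * complex.Im (g y)
              + complex.Im (f y) * complex.Re (g y))); last first.
  by apply/funext => y; case: (f y) => a b; case: (g y).
rewrite (difD v fg1 fg2 dx Ux) (difD v fg3 fg4 dx Ux) (difN v f2g2 dx Ux).
rewrite (difM v f1 g1 dx Ux) (difM v f2 g2 dx Ux).
rewrite (difM v f1 g2 dx Ux) (difM v f2 g1 dx Ux).
case: (f x) => a b; case: (g x) => c d /=.
by apply/eqP; rewrite eq_complex /=; apply/andP; split; apply/eqP; ring.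
Qed.

Lemma cdif_cst i (a : R[i]) x v : cdif i (fun=> a) x v = 0.
Proof. by rewrite /cdif !dif_cst. Qed.

Lemma cdif_eq i U f g x v : open U ->
  (forall y, dom i y -> U y -> f y = g y) -> dom i x -> U x ->
  cdif i f x v = cdif i g x v.
Proof.
move=> oU fg dx Ux; rewrite /cdif.
by congr (_ +i* _)%C; apply: (dif_eq _ oU) => // y dy Uy; rewrite fg.
Qed.

End ComplexChartCalculus.

(** * Cut-off functions supported in a chart domain *)

Section Bump.
Variables (R : realType) (n : nat) (M : manifold R n).
Implicit Types (i j : chart M) (U : set M).

(** The Euclidean square is polynomial, hence smooth, unlike the sup norm of ['rV]. The Euclidean
    ball lies in the sup-norm ball of the same radius, whence [bump_eq0]. *)
Definition bump_fun (y0 : 'rV[R]_n) (r : R) (y : 'rV[R]_n) : R :=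
  flat 0 (r ^+ 2 - \sum_k (y 0 k - y0 0 k) ^+ 2).

Lemma Ck_bump k y0 r : Ck k setT (bump_fun y0 r).
Proof.
apply: Ck_flat; first exact: openT.
apply: (CkD openT (@Ck_cst R _ R k _ (r ^+ 2))); apply: (CkN openT).
apply: Ck_sum => [|l _]; first exact: openT.
have cl : Ck k setT (fun y : 'rV[R]_n => y 0 l - y0 0 l : R).
  exact: (CkD openT (Ck_coord k setT l) (@Ck_cst R _ R k _ (- y0 0 l))).
exact: (CkM openT cl cl).
Qed.

Lemma bump_center_neq0 y0 r : 0 < r -> bump_fun y0 r y0 != 0.
Proof.
move=> r0; rewrite /bump_fun big1 => [|k _]; last by rewrite subrr expr0n.
by rewrite subr0 /flat exprn_gt0 // expr0 mul1r gt_eqF // expR_gt0.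
Qed.

Lemma bump_eq0 y0 r y : 0 < r -> ~ (`|y0 - y| <= r) -> bump_fun y0 r y = 0.
Proof.
move=> r0 yr; rewrite /bump_fun /flat subr_gt0; case: ifP => // sr; exfalso;
  apply: yr.
apply: rV_norm_le => [|k]; first exact: ltW.
rewrite -ler_sqr ?nnegrE ?normr_ge0 ?(ltW r0) // real_normK ?num_real //.
apply: le_trans (ltW sr); rewrite (bigD1 k) //= !mxE -sqrrN opprB lerDl.
by apply: sumr_ge0 => l _; exact: sqr_ge0.
Qed.

(** [K] is the image in [M] of a compact coordinate ball. It is compact, hence closed in the
    Hausdorff space [M] and not merely in the chart domain. *)
Lemma exists_bump_support i U (x0 : M) : open U -> dom i x0 -> U x0 ->
  exists r : R, exists K : set M,
    [/\ 0 < r, closed K, K `<=` dom i `&` U &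
      forall x, dom i x -> ~ K x -> bump_fun (coord i x0) r (coord i x) = 0].
Proof.
move=> oU dx0 Ux0; have oV := open_image_chart (i := i) oU.
have xV : (coord i @` (dom i `&` U)) (coord i x0) by exists x0.
have [e /= e0 eV] :=
  (nbhs_ballP (coord i x0) _).1 (open_nbhs_nbhs (conj oV xV)).
(* Halving the radius puts the closed ball inside the open ball of radius [e]. *)
have r0 : 0 < e / 2 by rewrite divr_gt0.
pose B := closed_ball (coord i x0) (e / 2).
have BE : B = [set y | `|coord i x0 - y| <= e / 2] by rewrite /B closed_ballE.
have BV : B `<=` coord i @` (dom i `&` U).
  rewrite BE => y /= yB; apply: eV; rewrite -ball_normE /=.
  by apply: le_lt_trans yB _; rewrite ltr_pdivrMr // ltr_pMr // ltr1n.
exists (e / 2), (point i @` B); split => //.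
- apply: compact_closed; first exact: manifold_hausdorff.
  apply: continuous_compact.
    apply: continuous_in_subspaceT => y; rewrite inE => /BV yV.
    by apply: point_continuous; have [dy _ yE] := image_chartP yV;
      exists (point i y).
  apply: bounded_closed_compact; last exact: closed_ball_closed.
  exists (`|coord i x0| + e / 2); split; first exact: num_real.
  move=> a ha y; rewrite BE /= => yB; apply: ltW; apply: le_lt_trans ha.
  rewrite -[y in `|y|](subrK (coord i x0)) addrC.
  by rewrite (le_trans (ler_normD _ _)) // lerD2l distrC.
- by move=> _ [y /BV yV <-]; have [] := image_chartP yV.
- move=> x dx xK; apply: bump_eq0 => // xB; apply: xK.
  by exists (coord i x); [rewrite BE | rewrite coordK].
Qed.

(* Smooth near points of [dom i] by the chain rule, and near the others because
   it vanishes off the closed set [K]. *)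
Lemma cchart_smooth_transplant i j U (K : set M) (G : 'rV[R]_n -> R)
    (h : M -> R[i]) :
  open U -> closed K -> K `<=` dom i -> (forall k, Ck k setT G) ->
  (forall x, dom i x -> ~ K x -> G (coord i x) = 0) ->
  cchart_smooth j (dom i `&` U) h ->
  cchart_smooth j U
    (fun x => if x \in dom i then (G (coord i x))%:C%C * h x else 0).
Proof.
move=> oU cK Ki HG G0 Hh; have oi := dom_open i.
have oiU : open (dom i `&` U) by exact: openI.
have sG : chart_smooth j (dom i) (G \o coord i).
  move=> k; apply: (@Ck_comp R _ n k _ setT G (coord i \o point j)) => //.
  - exact: open_image_chart.
  - exact: openT.
  - exact: transition_smooth.
have sF : cchart_smooth j (dom i `&` U)
    (fun x => if x \in dom i then (G (coord i x))%:C%C * h x else 0).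
  have sG' : cchart_smooth j (dom i `&` U) (fun x => (G (coord i x))%:C%C).
    by apply/cchart_smooth_real; apply: chart_smooth_sub sG => x [_ []].
  apply: cchart_smooth_eq (cchart_smoothM oiU sG' Hh) => //.
  by move=> x _ [dx _]; rewrite mem_set.
have s0 : cchart_smooth j (~` K)
    (fun x => if x \in dom i then (G (coord i x))%:C%C * h x else 0).
  have oK : open (~` K) by exact: closed_openC.
  apply: cchart_smooth_eq (cchart_smooth_cst j _ 0) => // x _ xK.
  by case: ifPn => //; rewrite inE => dx; rewrite G0 // mul0r.
split; apply: chart_smooth_local => x Ux _; have [dx|dx] := pselect (dom i x).
- by exists (dom i `&` U) => //; case: sF.
- by exists (~` K); [move=> /Ki | case: s0].
- by exists (dom i `&` U) => //; case: sF.
- by exists (~` K); [move=> /Ki | case: s0].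
Qed.

End Bump.

(** * The Dirac operator *)

Section RiemannianChart.
Variables (R : realType) (n : nat) (M : riemannian R n).
Implicit Types (i : chart M) (x : M).

(** A nonzero vector in the kernel would have zero length, against positivity. *)
Lemma metric_unitmx i x : dom i x -> metric M i x \in unitmx.
Proof.
move=> dx; rewrite -row_free_unit -kermx_eq0; apply/eqP/row_matrixP => k.
rewrite row0; apply/eqP; apply: contraT => v0.
have := metric_pos dx v0; rewrite /bil.
by rewrite (sub_kermxP (row_sub k _)) mul0mx mxE ltxx.
Qed.

Lemma chart_smooth_dom (i : chart M) (U : set M) (f : M -> R) :
  chart_smooth i (dom i) f -> chart_smooth i U f.
Proof. by apply: chart_smooth_sub => x []. Qed.

Lemma smooth_on_dom (W : normedModType R) i (F : M -> W) :
  smooth_on (dom i) F -> Cinfty (coord i @` (dom i `&` dom i)) (F \o point i).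
Proof. by apply. Qed.

Lemma mx_smooth_metric i : mx_smooth i (dom i) (metric M i).
Proof.
apply: smooth_on_mx; first exact: dom_open.
exact: smooth_on_dom (metric_smooth i).
Qed.

Lemma mx_smooth_dif i p q (F : M -> 'M[R]_(p, q)) (e : M -> 'rV[R]_n) :
  smooth_on (dom i) F -> mx_smooth i (dom i) e ->
  mx_smooth i (dom i) (fun x => dif i F x (e x)).
Proof.
move=> HF He a b; have oi := dom_open i.
have sF := smooth_on_dom HF.
apply: chart_smooth_eq (chart_smooth_dif oi (smooth_on_mx oi sF a b) He) => //.
by move=> x dx _; rewrite (dif_mx _ _ _ oi sF dx dx).
Qed.

Lemma dif_coord i x v : dom i x -> dif i (coord i) x v = v.
Proof.
move=> dx; rewrite /dif -[RHS](@derive_id R _ (coord i x) v).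
apply: near_eq_derive.
have xV : (coord i @` dom i) (coord i x) by exists x.
have := open_nbhs_nbhs (conj (@coord_open _ _ _ i) xV); apply: filterS.
by move=> _ [y dy <-] /=; rewrite coordK.
Qed.

Lemma mx_smooth_christoffel i (u w : M -> 'rV[R]_n) :
  mx_smooth i (dom i) u -> mx_smooth i (dom i) w ->
  mx_smooth i (dom i) (fun x => christoffel i x (u x) (w x)).
Proof.
move=> Hu Hw; have oi := dom_open i; have sm := metric_smooth i.
apply: mx_smoothM => //; last first.
  by apply: mx_smooth_inv => // [x dx _|];
    [exact: metric_unitmx | exact: mx_smooth_metric].
move=> a l; have Hd := mx_smooth_cst i (dom i) (delta_mx 0 l : 'rV[R]_n).
have : chart_smooth i (dom i) (fun x =>
    2^-1 * (bil (dif i (metric M i) x (u x)) (w x) (delta_mx 0 l)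
                 + bil (dif i (metric M i) x (w x)) (u x) (delta_mx 0 l)
                 - bil (dif i (metric M i) x (delta_mx 0 l)) (u x) (w x))).
  apply: chart_smoothM => //; first exact: chart_smooth_cst.
  apply: chart_smoothB => //; last first.
    by apply: (chart_smooth_bil oi) => //; exact: mx_smooth_dif.
  by apply: chart_smoothD => //; apply: (chart_smooth_bil oi) => //;
    exact: mx_smooth_dif.
by apply: chart_smooth_eq => // x _ _; rewrite mxE.
Qed.

End RiemannianChart.

Section DiracCalculus.
Variables (R : realType) (M : riemannian R 2) (S : spin_structure M).
Implicit Types (i : chart M) (x : M) (U : set M) (psi : spinor M).

Lemma mx_smooth_e1 i : mx_smooth i (dom i) (e1 S i).
Proof.
apply: smooth_on_mx; first exact: dom_open.
exact: smooth_on_dom (e1_smooth S i).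
Qed.

Lemma mx_smooth_e2 i : mx_smooth i (dom i) (e2 S i).
Proof.
apply: smooth_on_mx; first exact: dom_open.
exact: smooth_on_dom (e2_smooth S i).
Qed.

Lemma chart_smooth_connection_form i (e : M -> 'rV[R]_2) :
  mx_smooth i (dom i) e ->
  chart_smooth i (dom i) (fun x => connection_form S i x (e x)).
Proof.
move=> He; have oi := dom_open i.
apply: (chart_smooth_bil oi); [exact: mx_smooth_metric| |exact: mx_smooth_e2].
apply: mx_smoothD => //; first by apply: mx_smooth_dif => //; exact: e1_smooth.
apply: mx_smooth_eq (mx_smooth_christoffel He (mx_smooth_e1 i)) => // x dx _.
by rewrite dif_coord.
Qed.

(** Only frame [i] is involved, without the transition rule. Since [dirac S psi i] depends on
    [psi i] alone, [dirac] can be iterated without proving that its values form a spinor field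
    again. *)
Definition spinor_smooth i U psi :=
  forall a, cchart_smooth i U (fun x => psi i x a 0).

Lemma spinor_smoothD i U psi1 psi2 : open U -> spinor_smooth i U psi1 ->
  spinor_smooth i U psi2 -> spinor_smooth i U (fun i x => psi1 i x + psi2 i x).
Proof.
move=> oU H1 H2 a.
apply: cchart_smooth_eq (cchart_smoothD oU (H1 a) (H2 a)) => // x _ _.
by rewrite mxE.
Qed.

Lemma spinor_smoothZ i U (f : M -> R[i]) psi : open U -> cchart_smooth i U f ->
  spinor_smooth i U psi -> spinor_smooth i U (fun i x => f x *: psi i x).
Proof.
move=> oU Hf H a; apply: cchart_smooth_eq (cchart_smoothM oU Hf (H a)) => //.
by move=> x _ _; rewrite mxE.
Qed.

Lemma spinor_smooth_mulmx i U (A : 'M[R[i]]_2) psi : open U ->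
  spinor_smooth i U psi -> spinor_smooth i U (fun i x => A *m psi i x).
Proof.
move=> oU H a.
have : cchart_smooth i U (fun x => \sum_b A a b * psi i x b 0).
  apply: cchart_smooth_sum => // b _; apply: cchart_smoothM => //.
  exact: cchart_smooth_cst.
by apply: cchart_smooth_eq => // x _ _; rewrite mxE.
Qed.

Lemma spinor_smooth_nabla i U psi (e : M -> 'rV[R]_2) : open U ->
  mx_smooth i (dom i) e -> spinor_smooth i U psi ->
  spinor_smooth i U (fun i' x => spin_nabla S psi i' x (e x)).
Proof.
move=> oU He H a.
have He' : mx_smooth i U e by move=> b c; exact: chart_smooth_dom.
have Hc :
    cchart_smooth i U (fun x => (2^-1 * connection_form S i x (e x))%:C%C).
  apply/cchart_smooth_real/chart_smoothM => //; first exact: chart_smooth_cst.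
  exact/chart_smooth_dom/chart_smooth_connection_form.
have := cchart_smoothD oU (cchart_smooth_cdif oU (H a) He')
  (cchart_smoothM oU Hc (spinor_smooth_mulmx (omega R) oU H a)).
by apply: cchart_smooth_eq => // x _ _; rewrite !mxE.
Qed.

Lemma spinor_smooth_dirac i U psi : open U ->
  spinor_smooth i U psi -> spinor_smooth i U (dirac S psi).
Proof.
move=> oU H.
have H1 := spinor_smooth_nabla oU (mx_smooth_e1 i) H.
have H2 := spinor_smooth_nabla oU (mx_smooth_e2 i) H.
have := spinor_smoothD oU (spinor_smooth_mulmx (E1 R) oU H1)
  (spinor_smooth_mulmx (E2 R) oU H2).
by move=> H3 a; apply: cchart_smooth_eq (H3 a).
Qed.

End DiracCalculus.

(** * Relations in the two-dimensional Clifford algebra *)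

Section CliffordRelations.
Variable R : realType.
Local Notation E1 := (E1 R).
Local Notation E2 := (E2 R).
Local Notation omega := (omega R).

Let delta2 : (1%:M : 'M[R[i]]_2) = delta_mx 0 0 + delta_mx 1 1.
Proof.
rewrite mx1_sum_delta !big_ord_recl big_ord0 addr0.
by congr (_ + delta_mx _ _); apply/val_inj.
Qed.

Lemma E1_sqr : E1 *m E1 = - 1%:M.
Proof.
rewrite /Defs.E1 -scalemxAl -scalemxAr scalerA -expr2 sqr_i scaleN1r mulmxDl
  !mulmxDr.
by rewrite !mul_delta_mx_cond /= !mulr0n add0r addr0 !mulr1n delta2.
Qed.

Lemma E2_sqr : E2 *m E2 = - 1%:M.
Proof.
rewrite /Defs.E2 mulmxBl !mulmxBr !mul_delta_mx_cond /= !mulr0n !mulr1n delta2.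
by rewrite sub0r subr0 opprD addrC.
Qed.

Lemma omegaE : omega = 'i%C *: (delta_mx 0 0 - delta_mx 1 1).
Proof.
rewrite /Defs.omega /Defs.E1 /Defs.E2 -scalemxAl mulmxDl !mulmxBr.
by rewrite !mul_delta_mx_cond /= !mulr0n !mulr1n subr0 sub0r.
Qed.

Lemma E2E1 : E2 *m E1 = - omega.
Proof.
rewrite omegaE /Defs.E1 /Defs.E2 -scalemxAr mulmxBl !mulmxDr.
by rewrite !mul_delta_mx_cond /= !mulr0n !mulr1n addr0 add0r -scalerN opprB.
Qed.

Lemma E1_omega : E1 *m omega = - E2.
Proof. by rewrite /Defs.omega mulmxA E1_sqr mulNmx mul1mx. Qed.

Lemma omega_E2 : omega *m E2 = - E1.
Proof. by rewrite /Defs.omega -mulmxA E2_sqr mulmxN mulmx1. Qed.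

Lemma E2_omega : E2 *m omega = E1.
Proof.
by rewrite -[omega]opprK -E2E1 mulmxN mulmxA E2_sqr mulNmx mul1mx opprK.
Qed.

Lemma omega_E1 : omega *m E1 = E2.
Proof.
by rewrite -[omega]opprK -E2E1 mulNmx -mulmxA E1_sqr mulmxN mulmx1 opprK.
Qed.

Lemma omega_sqr : omega *m omega = - 1%:M.
Proof. by rewrite {1}/Defs.omega -mulmxA E2_omega E1_sqr. Qed.

(** The matrices [E1], [E2] are off-diagonal while [1], [omega] are diagonal, so the four entries
    split into two pairs, each giving a sum and a difference that vanish. *)
Lemma clifford_combination_eq0 (u v a b : R[i]) :
  u *: E1 + v *: E2 + a%:M + b *: omega = 0 -> [/\ u = 0, v = 0, a = 0 & b = 0].
Proof.
have i0 : 'i%C != 0 :> R[i] by rewrite eq_complex /= eqxx oner_eq0.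
have two0 : (2 : R[i]) != 0 by rewrite pnatr_eq0.
have half (z w : R[i]) : z + w = 0 -> z - w = 0 -> z = 0 /\ w = 0.
  move=> h1 h2; have : 2 * z = (z + w) + (z - w) by ring.
  rewrite h1 h2 addr0.
  move/eqP; rewrite mulf_eq0 (negbTE two0) /= => /eqP z0.
  by move: h1; rewrite z0 add0r.
move/matrixP => H.
have := (H 0 0, H 0 1, H 1 0, H 1 1); rewrite omegaE /Defs.E1 /Defs.E2 !mxE /=.
rewrite !(mulr0, mulr1, mulr1n, mulr0n, addr0, add0r, subr0, sub0r, oppr0,
  mulrN).
move=> [[[H00 H01] H10] H11].
have [a0 b0] := half _ _ H00 H11.
have [u0 v0] := half _ _ H10 H01.
have cancel_i (z : R[i]) : z * 'i%C = 0 -> z = 0.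
  by move/eqP; rewrite mulf_eq0 (negbTE i0) orbF => /eqP.
by split=> //; exact: cancel_i.
Qed.

End CliffordRelations.

(** * Leibniz rules for the Dirac operator *)

Section DiracProductRules.
Variables (R : realType) (M : riemannian R 2) (S : spin_structure M).
Variables (i : chart M) (U : set M) (x : M).
Hypotheses (oU : open U) (dx : dom i x) (Ux : U x).
Implicit Types (f : M -> R[i]) (psi : spinor M).

Local Notation smooth := (spinor_smooth i U).

Lemma spin_nablaD psi1 psi2 v : smooth psi1 -> smooth psi2 ->
  spin_nabla S (fun i x => psi1 i x + psi2 i x) i x v =
  spin_nabla S psi1 i x v + spin_nabla S psi2 i x v.
Proof.
move=> H1 H2; rewrite /spin_nabla mulmxDr scalerDr addrACA; congr (_ + _).
apply/colP => a; rewrite !mxE -(cdifD v (H1 a) (H2 a) dx Ux).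
by congr (cdif i _ x v); apply/funext => y; rewrite mxE.
Qed.

Lemma spin_nablaZ f psi v : cchart_smooth i U f -> smooth psi ->
  spin_nabla S (fun i x => f x *: psi i x) i x v =
  cdif i f x v *: psi i x + f x *: spin_nabla S psi i x v.
Proof.
move=> Hf H; rewrite /spin_nabla scalerDr addrA; congr (_ + _); last first.
  by rewrite -scalemxAr !scalerA mulrC.
apply/colP => a; rewrite !mxE -(cdifM v oU Hf (H a) dx Ux).
by congr (cdif i _ x v); apply/funext => y; rewrite mxE.
Qed.

(** [omega] is parallel: it is constant in the spin frame and commutes with the connection term,
    itself a multiple of [omega]. *)
Lemma spin_nabla_omega psi v : smooth psi ->
  spin_nabla S (fun i x => omega R *m psi i x) i x v =
  omega R *m spin_nabla S psi i x v.
Proof.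
move=> H; rewrite /spin_nabla mulmxDr scalemxAr; congr (_ + _).
have E a : (fun y => (omega R *m psi i y) a 0) =
    (fun y => omega R a 0 * psi i y 0 0 + omega R a 1 * psi i y 1 0).
  apply/funext => y; rewrite mxE !big_ord_recl big_ord0 addr0.
  have -> : fintype.lift ord0 ord0 = 1 :> 'I_2 by apply/val_inj.
  by [].
apply/colP => a; rewrite mxE [RHS]mxE E.
have cs b := cchart_smooth_cst i U (omega R a b).
rewrite (cdifD v (cchart_smoothM oU (cs 0) (H 0))
  (cchart_smoothM oU (cs 1) (H 1)) dx Ux).
rewrite !(cdifM v oU _ _ dx Ux) // !cdif_cst !mul0r !add0r.
rewrite !big_ord_recl big_ord0 addr0 ![(\col__ _) _ _]mxE.
by have -> : fintype.lift ord0 ord0 = 1 :> 'I_2 by apply/val_inj.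
Qed.

Lemma diracD psi1 psi2 : smooth psi1 -> smooth psi2 ->
  dirac S (fun i x => psi1 i x + psi2 i x) i x =
  dirac S psi1 i x + dirac S psi2 i x.
Proof.
move=> H1 H2; rewrite /dirac !spin_nablaD //.
move: (spin_nabla _ _ _ _ _) (spin_nabla _ psi2 _ _ _)
  (spin_nabla _ psi1 _ _ (e2 _ _ _)) (spin_nabla _ psi2 _ _ _) => a b c d.
by rewrite !mulmxDr addrACA.
Qed.

Definition clifford_grad f : 'M[R[i]]_2 :=
  cdif i f x (e1 S i x) *: E1 R + cdif i f x (e2 S i x) *: E2 R.

Lemma diracZ f psi : cchart_smooth i U f -> smooth psi ->
  dirac S (fun i x => f x *: psi i x) i x =
  clifford_grad f *m psi i x + f x *: dirac S psi i x.
Proof.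
move=> Hf H; rewrite /dirac !spin_nablaZ //.
rewrite /clifford_grad.
move: (spin_nabla _ _ _ _ _) (spin_nabla _ _ _ _ _) (E1 R) (E2 R) => a b F1 F2.
by rewrite !mulmxDr scalerDr addrACA -!scalemxAr mulmxDl -!scalemxAl.
Qed.

Lemma dirac_omega psi : smooth psi ->
  dirac S (fun i x => omega R *m psi i x) i x = - (omega R *m dirac S psi i x).
Proof.
move=> H; rewrite /dirac !spin_nabla_omega //.
move: (spin_nabla _ _ _ _ _) (spin_nabla _ _ _ _ _) => a b.
rewrite [in RHS]mulmxDr.
rewrite (mulmxA (E1 R) (omega R)) (mulmxA (E2 R) (omega R)).
rewrite (mulmxA (omega R) (E1 R)) (mulmxA (omega R) (E2 R)).
by rewrite E1_omega E2_omega omega_E1 omega_E2 !mulNmx opprD opprK.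
Qed.

Lemma scalar_chiral_comp a b p q psi :
  cchart_smooth i U p -> cchart_smooth i U q -> smooth psi ->
  scalar_chiral S a b (scalar_chiral S p q psi) i x =
  dirac S (dirac S psi) i x + (p x + a x) *: dirac S psi i x
  + (b x - q x) *: (omega R *m dirac S psi i x)
  + (clifford_grad p + clifford_grad q *m omega R) *m psi i x
  + (a x * p x - b x * q x) *: psi i x
  + (a x * q x + b x * p x) *: (omega R *m psi i x).
Proof.
move=> Hp Hq H; have Hd := spinor_smooth_dirac S oU H.
have Ho := spinor_smooth_mulmx (omega R) oU H.
have Hpp := spinor_smoothZ oU Hp H; have Hqo := spinor_smoothZ oU Hq Ho.
rewrite /scalar_chiral.
rewrite (diracD (spinor_smoothD oU Hd Hpp) Hqo) (diracD Hd Hpp).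
rewrite diracZ // (diracZ Hq Ho) dirac_omega //.
have := omega_sqr R.
move: (dirac S (dirac S psi) i x) (dirac S psi i x) (psi i x) (clifford_grad p)
  (clifford_grad q) (omega R) => ddp dp s gp gq w ww.
rewrite !mulmxDr -!scalemxAr (mulmxA w w) ww mulNmx mul1mx mulmxDl -mulmxA.
by apply/colP => k; rewrite !mxE; ring.
Qed.

End DiracProductRules.

(** * Test spinors *)

Section TestSpinors.
Variables (R : realType) (M : riemannian R 2) (S : spin_structure M).
Implicit Types (i j : chart M) (x : M) (U K : set M).

(** Since [omega] squares to [- 1], the real combinations of [1] and [omega] multiply like complex
    numbers. *)
Lemma spin_actionM (z w : R[i]) :
  spin_action (z * w) = spin_action z *m spin_action w.
Proof.
case: z => a b; case: w => c d; rewrite /spin_action /=.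
have := omega_sqr R; move: (omega R) => w ww.
rewrite mulmxDl !mulmxDr !mul_scalar_mx -!scalemxAl
  -!scalemxAr mul_mx_scalar ww.
apply/matrixP => k l; rewrite !mxE !(rmorphB, rmorphD, rmorphM) /=.
by case: (k == l); rewrite ?mulr1n ?mulr0n; ring.
Qed.

Lemma spin_action1 : spin_action (1 : R[i]) = 1%:M.
Proof. by rewrite /spin_action /= scale0r addr0. Qed.

(** The cocycle identity makes this unit-modulus number idempotent, hence equal to one. *)
Lemma lift_refl i x : dom i x -> Defs.lift S i i x = 1.
Proof.
move=> dx; have := lift_cocycle S dx dx dx.
have l0 : Defs.lift S i i x != 0 by rewrite -normr_eq0 lift_unit // oner_eq0.
by move/(congr1 (fun z => z / Defs.lift S i i x)); rewrite mulfK // divff.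
Qed.

(** The field with components [G s] in frame [i], carried to each frame [j] by the spin transition
    function and extended by zero; it is a genuine section once [G] is supported in the chart. *)
Definition test_spinor i (G : 'rV[R]_2 -> R) (s : 'cV[R[i]]_2) : spinor M :=
  fun j x => if x \in dom i
    then (G (coord i x))%:C%C *: (spin_action (Defs.lift S j i x) *m s) else 0.

Lemma test_spinorE i G s x : dom i x ->
  test_spinor i G s i x = (G (coord i x))%:C%C *: s.
Proof.
by move=> dx; rewrite /test_spinor mem_set // lift_refl // spin_action1 mul1mx.
Qed.

Lemma spinor_field_test_spinor i U K G s : open U -> closed K -> K `<=` dom i ->
  (forall k, Ck k setT G) ->
  (forall x, dom i x -> ~ K x -> G (coord i x) = 0) ->
  spinor_field S U (test_spinor i G s).
Proof.
move=> oU cK Ki HG G0; split=> [j a|j k x Ux dj dk]; last first.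
  rewrite /test_spinor; case: ifPn; last by rewrite mulmx0.
  rewrite inE => dx; rewrite -scalemxAr mulmxA -spin_actionM.
  by rewrite -(lift_cocycle S dj dk dx).
(* Components in frame [j] must be smooth in every chart [k], so frame and coordinates carry
   independent indices. *)
apply/csmooth_onP => k; have oj := dom_open j.
have oV : open (dom j `&` U) by exact: openI.
have [l1 l2] : cchart_smooth k (dom j `&` dom i) (Defs.lift S j i).
  by move/csmooth_onP: (lift_smooth S j i); exact.
have oji : open (dom i `&` (dom j `&` U)).
  by apply: openI => //; exact: dom_open.
have sub : dom k `&` (dom i `&` (dom j `&` U)) `<=` dom j `&` dom i.
  by move=> x [_ [? []]].
have h1 := cchart_smooth_real (chart_smooth_sub sub l1).
have h2 := cchart_smooth_real (chart_smooth_sub sub l2).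
have Hh : cchart_smooth k (dom i `&` (dom j `&` U))
    (fun x => (spin_action (Defs.lift S j i x) *m s) a 0).
  have cs b := cchart_smooth_cst k (dom i `&` (dom j `&` U)) b.
  apply: cchart_smooth_eq (cchart_smoothD oji
    (cchart_smoothM oji h1 (cs (s a 0)))
    (cchart_smoothM oji h2 (cs ((omega R *m s) a 0)))) => // x _ _.
  by rewrite /spin_action mulmxDl mul_scalar_mx -scalemxAl !mxE.
have := cchart_smooth_transplant oV cK Ki HG G0 Hh.
apply: cchart_smooth_eq => // x _ _.
by rewrite /test_spinor; case: ifP => _; rewrite [RHS]mxE.
Qed.

Lemma dirac_eq i U x (psi1 psi2 : spinor M) : open U -> dom i x -> U x ->
  (forall y, dom i y -> U y -> psi1 i y = psi2 i y) ->
  dirac S psi1 i x = dirac S psi2 i x.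
Proof.
move=> oU dx Ux E.
have EN v : spin_nabla S psi1 i x v = spin_nabla S psi2 i x v.
  rewrite /spin_nabla (E _ dx Ux); congr (_ + _); apply/colP => a; rewrite !mxE.
  by apply: (cdif_eq _ oU) => // y dy Uy; rewrite E.
by rewrite /dirac !EN.
Qed.

(** Where [G] vanishes, the Leibniz rule loses its undifferentiated term, and the connection form
    with it; only the principal symbol acting on [s] is left. *)
Lemma dirac_test_spinor i G s x : dom i x -> (forall k, Ck k setT G) ->
  G (coord i x) = 0 ->
  dirac S (test_spinor i G s) i x =
  (('D_(e1 S i x) G (coord i x))%:C%C *: E1 R
   + ('D_(e2 S i x) G (coord i x))%:C%C *: E2 R) *m s.
Proof.
move=> dx HG G0; have oi := dom_open i.
have sG : chart_smooth i (dom i) (fun x => G (coord i x)).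
  move=> k; apply: Ck_eq (Ck_sub (@subsetT _ _) (HG k));
    first exact: open_image_chart.
  by move=> y /image_chartP[_ _ /= ->].
rewrite (@dirac_eq i (dom i) x _ (fun j y => (G (coord i y))%:C%C *: s)) //;
  last first.
  by move=> y dy _; exact: test_spinorE.
rewrite (diracZ S oi dx dx (cchart_smooth_real sG) (psi := fun _ _ => s));
  last first.
  by move=> a; exact: cchart_smooth_cst.
rewrite G0 scale0r addr0; congr (_ *m _).
have E v :
    cdif i (fun y => (G (coord i y))%:C%C) x v = ('D_v G (coord i x))%:C%C.
  rewrite /cdif /= dif_cst; congr (_ +i* _)%C; apply: near_eq_derive.
  have xV : (coord i @` dom i) (coord i x) by exists x.
  have := open_nbhs_nbhs (conj (@coord_open _ _ _ i) xV); apply: filterS.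
  by move=> _ [y dy <-] /=; rewrite coordK.
by rewrite /clifford_grad !E.
Qed.

End TestSpinors.

Section LinearBump.
Variables (R : realType) (n : nat).

(** A cut-off linear form: it vanishes at [y0], and for [r > 0] its differential there is a nonzero
    multiple of the covector [w]. *)
Definition linear_bump (y0 : 'rV[R]_n) (r : R) (w : 'cV[R]_n)
    (y : 'rV[R]_n) : R :=
  bump_fun y0 r y * ((y - y0) *m w) 0 0.

Lemma Ck_linear (y0 : 'rV[R]_n) (w : 'cV[R]_n) k :
  Ck k setT (fun y : 'rV[R]_n => ((y - y0) *m w) 0 0 : R).
Proof.
have : Ck k setT (fun y : 'rV[R]_n => \sum_l (y 0 l - y0 0 l) * w l 0 : R).
  apply: Ck_sum => [|l _]; first exact: openT.
  apply: (CkM openT _ (@Ck_cst R _ R k _ (w l 0))).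
  exact: (CkD openT (Ck_coord k setT l) (@Ck_cst R _ R k _ (- y0 0 l))).
apply: Ck_eq => [|y _]; first exact: openT.
by rewrite mxE; apply: eq_bigr => l _; rewrite !mxE.
Qed.

Lemma Ck_linear_bump k y0 r w : Ck k setT (linear_bump y0 r w).
Proof. exact: (CkM openT (Ck_bump k y0 r) (Ck_linear y0 w k)). Qed.

Lemma linear_bump_center y0 r w : linear_bump y0 r w y0 = 0.
Proof. by rewrite /linear_bump subrr mul0mx mxE mulr0. Qed.

Lemma derive_linear_bump y0 r w v :
  'D_v (linear_bump y0 r w) y0 = bump_fun y0 r y0 * (v *m w) 0 0.
Proof.
pose l (y : 'rV[R]_n) : R := ((y - y0) *m w) 0 0.
have [_ /(_ v)[db _]] := Ck_bump 1 y0 r.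
have [_ /(_ v)[dl _]] := Ck_linear y0 w 1.
have := deriveM (db y0 I) (dl y0 I).
rewrite (_ : bump_fun y0 r * _ = linear_bump y0 r w) // => ->.
rewrite subrr mul0mx mxE scale0r addr0; congr (_ * _).
(* The difference quotient of an affine function is constant for [h] nonzero. *)
apply: lim_near_cst => //; near=> h.
have h0 : h != 0 by near: h; exact: nbhs_dnbhs_neq.
rewrite /= subrr mul0mx addrK -scalemxAl !mxE subr0.
by rewrite [_ *: _]mulrA mulVf // mul1r.
Unshelve. all: by end_near. Qed.

End LinearBump.

(** * Mean curvature, gradients and the factorization *)

Section MeanCurvature.
Variables (R : realType) (n : nat) (M : riemannian R 2) (N : riemannian R n).
Variables (phi : M -> N) (xi : unit_normal phi) (A : shape_operator xi).
Implicit Types (i j : chart M) (x : M).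

(** Invertibility is read off the metric rather than the inverse transition: a vector sent to zero
    would have zero length in chart [j], hence also in chart [i]. *)
Lemma dif_coord_mulmx i j x : dom i x -> dom j x ->
  exists2 P : 'M[R]_2, P \in unitmx & forall v, dif i (coord j) x v = v *m P.
Proof.
move=> dix djx; have oj := dom_open j.
have st := transition_smooth (m := M) i j.
pose P : 'M[R]_2 :=
  \matrix_(l, k) dif i (fun y => coord j y 0 k) x (delta_mx 0 l).
have PE v : dif i (coord j) x v = v *m P.
  apply/rowP => k; rewrite (dif_mx _ _ _ oj st dix djx).
  rewrite (dif_linear v oj (smooth_on_mx oj st 0 k) dix djx) mxE.
  by apply: eq_bigr => l _; rewrite mxE.
exists P => //; rewrite -row_free_unit -kermx_eq0; apply/eqP/row_matrixP => k.
rewrite row0; apply/eqP; apply: contraT => v0.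
have := metric_pos dix v0; rewrite (metric_change dix djx) !PE.
by rewrite (sub_kermxP (row_sub k _)) /bil !mul0mx mxE ltxx.
Qed.

(** The two matrices are conjugate. This is what makes [mean_curvature] smooth, as [chart_at x] may
    jump with [x] and has to be traded for a fixed chart. *)
Lemma trace_shape_chart i j x : dom i x -> dom j x -> \tr (A i x) = \tr (A j x).
Proof.
move=> dix djx; have [P uP PE] := dif_coord_mulmx dix djx.
have : A i x *m P = P *m A j x.
  apply/row_matrixP => k; rewrite !rowE !mulmxA -!PE.
  exact: (shape_change A dix djx).
move/(congr1 (mulmx (invmx P))); rewrite mulKmx // => <-.
by rewrite mxtrace_mulC mulmxK.
Qed.

Lemma chart_smooth_mean_curvature i (U : set M) :
  chart_smooth i U (mean_curvature A).
Proof.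
apply: chart_smooth_dom; have oi := dom_open i.
have sA : mx_smooth i (dom i) (A i).
  exact: smooth_on_mx oi (smooth_on_dom (shape_smooth A i)).
have : chart_smooth i (dom i) (fun x => 2^-1 * \tr (A i x)).
  apply: chart_smoothM => //; first exact: chart_smooth_cst.
  by apply: chart_smooth_sum => // k _; exact: sA.
apply: chart_smooth_eq => // x dx _.
by rewrite /mean_curvature (trace_shape_chart dx (dom_chart_at x)).
Qed.

End MeanCurvature.

(** * Gradients and rotation in an orthonormal frame *)

Section Frame.
Variables (R : realType) (M : riemannian R 2) (S : spin_structure M).
Variables (i : chart M) (x : M).
Hypothesis dx : dom i x.

Local Notation G := (metric M i x).
Local Notation f1 := (e1 S i x).
Local Notation f2 := (e2 S i x).
Local Notation C := (map_mx (real_complex R)).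

Let mx11 (u : 'M[R]_1) a : u 0 0 = a -> u = a%:M.
Proof. by move=> <-; exact: mx11_scalar. Qed.

Lemma frame_gram :
  [/\ f1 *m G *m f1^T = 1%:M, f2 *m G *m f2^T = 1%:M, f1 *m G *m f2^T = 0
    & f2 *m G *m f1^T = 0].
Proof.
have [g11 g22 g12] := frame_orthonormal S dx.
have g12' : f1 *m G *m f2^T = 0 by rewrite (mx11 g12) raddf0.
split=> //; [exact: mx11 | exact: mx11 |].
by apply: trmx_inj; rewrite !trmx_mul trmxK metric_sym // mulmxA g12' trmx0.
Qed.

(** The completeness relation of an orthonormal frame. Multiplying the right side by the metric
    fixes both frame vectors, which form an invertible matrix [F] by positivity of the frame. *)
Lemma invmx_metric_frame : invmx G = f1^T *m f1 + f2^T *m f2.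
Proof.
have [g11 g22 g12 g21] := frame_gram; have uG := metric_unitmx dx.
pose F : 'M[R]_2 := col_mx f1 f2.
have uF : F \in unitmx by rewrite unitmxE unitfE gt_eqF // frame_positive.
have FX : F *m (G *m (f1^T *m f1 + f2^T *m f2)) = F.
  rewrite /F (mul_col_mx f1 f2) !mulmxA !mulmxDr !mulmxA.
  by rewrite g11 g22 g12 g21 !mul1mx !mul0mx addr0 add0r.
have GX : G *m (f1^T *m f1 + f2^T *m f2) = 1%:M.
  by rewrite -[LHS](mulKmx uF) FX mulVmx.
by rewrite -[RHS](mulKmx uG) GX mulmx1.
Qed.

Lemma frame_J : f1 *m J S i x = f2 /\ f2 *m J S i x = - f1.
Proof.
have [g11 g22 g12 g21] := frame_gram.
rewrite /J !mulmxA !mulmxBr !mulmxA g11 g22 g12 g21 !mul1mx !mul0mx.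
by rewrite subr0 sub0r.
Qed.

Lemma grad_frame U f : open U -> chart_smooth i U f -> U x ->
  grad i f x = dif i f x f1 *: f1 + dif i f x f2 *: f2.
Proof.
move=> oU Hf Ux; rewrite /grad invmx_metric_frame mulmxDr !mulmxA.
have E v : (\row_l dif i f x (delta_mx 0 l)) *m v^T = (dif i f x v)%:M.
  apply: mx11; rewrite mxE (dif_linear v oU Hf dx Ux).
  by apply: eq_bigr => k _; rewrite !mxE mulrC.
by rewrite !E !mul_scalar_mx.
Qed.

Lemma cgrad_frame U f : open U -> cchart_smooth i U f -> U x ->
  cgrad i f x = cdif i f x f1 *: C f1 + cdif i f x f2 *: C f2.
Proof.
move=> oU [H1 H2] Ux; rewrite /cgrad !(grad_frame oU _ Ux) //.
rewrite !map_mxD !map_mxZ scalerDr !scalerA addrACA -!scalerDl /cdif.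
congr (_ *: _ + _ *: _); apply/eqP; rewrite eq_complex /=.
  by apply/andP; split; apply/eqP; ring.
by apply/andP; split; apply/eqP; ring.
Qed.

(** The metric pairing, extended complex-bilinearly, isolates one coefficient for each real frame
    vector. *)
Lemma cframe_free (u v : R[i]) : u *: C f1 + v *: C f2 = 0 -> u = 0 /\ v = 0.
Proof.
have [g11 g22 g12 g21] := frame_gram => uv.
have E (e : 'rV[R]_2) : u *: C (f1 *m G *m e^T) + v *: C (f2 *m G *m e^T) = 0.
  by rewrite -!mulmxA !map_mxM /= !scalemxAl -mulmxDl uv mul0mx.
split.
  have := E f1; rewrite g11 g21 map_mx0 scaler0 addr0 map_mx1.
  by move/matrixP/(_ 0 0); rewrite !mxE mulr1.
have := E f2; rewrite g12 g22 map_mx0 scaler0 add0r map_mx1.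
by move/matrixP/(_ 0 0); rewrite !mxE mulr1.
Qed.

(** Since [J] sends [e1] to [e2] and [e2] to [- e1], comparing frame coefficients turns the gradient
    equation into Cauchy-Riemann equations. *)
Lemma cgrad_eq_J U f g : open U -> cchart_smooth i U f ->
  cchart_smooth i U g -> U x ->
  cgrad i g x = cgrad i f x *m cJ S i x <->
  cdif i g x f1 = - cdif i f x f2 /\ cdif i g x f2 = cdif i f x f1.
Proof.
move=> oU Hf Hg Ux; have [J1 J2] := frame_J.
rewrite !(cgrad_frame oU _ Ux) // /cJ mulmxDl -!scalemxAl
  -!map_mxM J1 J2 map_mxN.
split=> [E|[-> ->]]; last by rewrite scalerN scaleNr addrC.
have : (cdif i g x f1 + cdif i f x f2) *: C f1 +
  (cdif i g x f2 - cdif i f x f1) *: C f2 = 0.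
  by rewrite !scalerDl addrACA E scalerN scaleNr [X in X + _]addrC addrACA
    addNr subrr addr0.
by move=> /cframe_free[/eqP h1 /eqP h2]; split; apply/eqP;
  [rewrite -addr_eq0 | rewrite -subr_eq0].
Qed.

End Frame.

(** * Pointwise form of the factorization *)

Section Factorization.
Variables (R : realType) (c : R) (eta : R[i]).
Variables (M : riemannian R 2) (S : spin_structure M) (N : riemannian R 3).
Variables (phi : M -> N) (xi : unit_normal phi) (A : shape_operator xi).
Variables (U : set M) (a b p q : M -> R[i]).
Hypothesis oU : open U.

Local Notation H x := ((mean_curvature A x)%:C%C).
Local Notation K x :=
  ((norm2_shape A x - mean_curvature A x ^+ 2 - 2 * c)%:C%C).

(** Both operators are monic, so the second-order terms cancel. The coefficients left are written in
    the basis [E1], [E2], [1], [omega], ready for [clifford_combination_eq0]. *)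
Lemma factorization_defect i x (psi : spinor M) : dom i x -> U x ->
  cchart_smooth i U p -> cchart_smooth i U q -> spinor_smooth i U psi ->
  scalar_chiral S a b (scalar_chiral S p q psi) i x - Bop c eta S A psi i x =
  ((p x + a x)%:M + (b x - q x - 2 * eta) *: omega R) *m dirac S psi i x
  + ((cdif i p x (e1 S i x) + cdif i q x (e2 S i x)) *: E1 R
     + (cdif i p x (e2 S i x) - cdif i q x (e1 S i x)) *: E2 R
     + (a x * p x - b x * q x - K x)%:M
     + (a x * q x + b x * p x + 2 * eta * H x) *: omega R) *m psi i x.
Proof.
move=> dx Ux Hp Hq Hpsi.
rewrite (scalar_chiral_comp S oU dx Ux a b Hp Hq Hpsi) /Bop.
have -> : clifford_grad S i x p + clifford_grad S i x q *m omega R =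
    (cdif i p x (e1 S i x) + cdif i q x (e2 S i x)) *: E1 R
    + (cdif i p x (e2 S i x) - cdif i q x (e1 S i x)) *: E2 R.
  rewrite /clifford_grad (mulmxDl (_ *: E1 R)) -(scalemxAl _ (E1 R))
    -(scalemxAl _ (E2 R)).
  rewrite E1_omega E2_omega.
  by move: (E1 R) (E2 R) => F1 F2; apply/matrixP => k l; rewrite !mxE; ring.
move: (dirac S (dirac S psi) i x) (dirac S psi i x) (psi i x) (omega R)
  (E1 R) (E2 R) (K x) (H x) => ddp dp s w F1 F2 k h.
rewrite !mulmxDl -!scalemxAl !mul_scalar_mx.
move: (w *m dp) (w *m s) (F1 *m s) (F2 *m s) => wd ws s1 s2.
by apply/colP => l; rewrite !mxE; ring.
Qed.

Lemma spinor_field_smooth i psi : spinor_field S U psi -> spinor_smooth i U psi.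
Proof.
move=> [Hpsi _] k; have /csmooth_onP/(_ i) := Hpsi i k.
by apply: cchart_smooth_sub => x [].
Qed.

Lemma factorizationP :
  factorization c eta S A U a b p q <->
  [/\ csmooth_on U a, csmooth_on U b, csmooth_on U p, csmooth_on U q &
    forall i x, dom i x -> U x ->
      [/\ p x + a x = 0, b x - q x - 2 * eta = 0,
          cdif i p x (e1 S i x) + cdif i q x (e2 S i x) = 0,
          cdif i p x (e2 S i x) - cdif i q x (e1 S i x) = 0 &
          a x * p x - b x * q x - K x = 0 /\
          a x * q x + b x * p x + 2 * eta * H x = 0]].
Proof.
split=> -[sa sb sp sq HF]; split=> //; last first.
  move=> psi Hpsi i x Ux dx.
  have Hp := (csmooth_onP U p).1 sp i; have Hq := (csmooth_onP U q).1 sq i.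
  have := factorization_defect dx Ux Hp Hq (spinor_field_smooth i Hpsi).
  have [-> -> -> -> [-> ->]] := HF i x dx Ux.
  rewrite !raddf0 !scale0r !addr0 !mul0mx addr0 => /eqP.
  by rewrite subr_eq0 => /eqP.
move=> i x dx Ux.
have Hp := (csmooth_onP U p).1 sp i; have Hq := (csmooth_onP U q).1 sq i.
have [r [L [r0 cL LU B0]]] := exists_bump_support oU dx Ux.
have Li : L `<=` dom i by move=> y /LU[].
set B := bump_fun (coord i x) r in B0.
have Bx : (B (coord i x))%:C%C != 0 by rewrite fmorph_eq0 bump_center_neq0.
(* The hypothesis on spinor fields is used only here, on test spinors supported in [L]. *)
have defect0 G s : (forall k, Ck k setT G) ->
    (forall y, dom i y -> ~ L y -> G (coord i y) = 0) ->
    scalar_chiral S a b (scalar_chiral S p q (test_spinor S i G s)) i x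
      - Bop c eta S A (test_spinor S i G s) i x = 0.
  move=> HG G0; have fG := spinor_field_test_spinor S s oU cL Li HG G0.
  by rewrite (HF _ fG i x Ux dx) subrr.
have mulmx_all0 (X : 'M[R[i]]_2) : (forall s : 'cV_2, X *m s = 0) -> X = 0.
  move=> X0; apply/matrixP => k l; have /colP/(_ k) := X0 (delta_mx l 0).
  by rewrite -colE !mxE.
have symbol0 : (p x + a x)%:M + (b x - q x - 2 * eta) *: omega R = 0.
  (* [y |-> g (y - x, e1)] has derivatives [1] along [e1] and [0] along [e2]. *)
  pose w := metric M i x *m (e1 S i x)^T.
  pose G := linear_bump (coord i x) r w.
  have HG k : Ck k setT G by exact: Ck_linear_bump.
  have G0 : G (coord i x) = 0 by exact: linear_bump_center.
  have Gs y : dom i y -> ~ L y -> G (coord i y) = 0.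
    by move=> dy Ly; rewrite /G /linear_bump -/B B0 // mul0r.
  have [g11 _ _ g21] := frame_gram S dx.
  have D1 : 'D_(e1 S i x) G (coord i x) = B (coord i x).
    by rewrite derive_linear_bump mulmxA g11 mxE mulr1.
  have D2 : 'D_(e2 S i x) G (coord i x) = 0.
    by rewrite derive_linear_bump mulmxA g21 mxE mulr0.
  have X0 : ((p x + a x)%:M + (b x - q x - 2 * eta) *: omega R) *m
      ((B (coord i x))%:C%C *: E1 R) = 0.
    apply: mulmx_all0 => s; have := defect0 G s HG Gs.
    have fG := spinor_field_test_spinor S s oU cL Li HG Gs.
    rewrite (factorization_defect dx Ux Hp Hq (spinor_field_smooth i fG)).
    rewrite dirac_test_spinor // test_spinorE // G0 D1 D2 !scale0r mulmx0
      !addr0.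
    by rewrite mulmxA.
  (* Clifford multiplication by a unit vector is invertible, so the single test direction [e1]
     already determines the symbol. *)
  have inv1 : ((B (coord i x))%:C%C *: E1 R)
      *m (- (B (coord i x))%:C%C^-1 *: E1 R) = 1%:M.
    move: (E1_sqr R); move: (E1 R) => F FF.
    by rewrite -scalemxAl -scalemxAr FF scalerA mulrN mulfV // scaleN1r opprK.
  by rewrite -[LHS]mulmx1 -inv1 mulmxA X0 mul0mx.
have [_ _ h1 h2] : [/\ (0 : R[i]) = 0, (0 : R[i]) = 0,
  p x + a x = 0 & b x - q x - 2 * eta = 0].
  by apply: clifford_combination_eq0; rewrite !scale0r !add0r.
have zero_order : (cdif i p x (e1 S i x) + cdif i q x (e2 S i x)) *: E1 R
     + (cdif i p x (e2 S i x) - cdif i q x (e1 S i x)) *: E2 R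
     + (a x * p x - b x * q x - K x)%:M
     + (a x * q x + b x * p x + 2 * eta * H x) *: omega R = 0.
  (* The bump alone now suffices: its derivative is irrelevant because [symbol0] kills the Dirac
     term, and its value at [x] is nonzero. *)
  apply: mulmx_all0 => s.
  have HG k : Ck k setT B by exact: Ck_bump.
  have fG := spinor_field_test_spinor S s oU cL Li HG B0.
  have := defect0 B s HG B0.
  rewrite (factorization_defect dx Ux Hp Hq (spinor_field_smooth i fG)).
  rewrite symbol0 mul0mx add0r test_spinorE // -scalemxAr => /eqP.
  by rewrite scaler_eq0 (negbTE Bx) /= => /eqP.
by have [h3 h4 h5 h6] := clifford_combination_eq0 zero_order; split.
Qed.

End Factorization.

Theorem corollary7p3 (R : realType) (c : R) (hc : c != 0)
    (N : riemannian R 3) (hNo : oriented N) (hN : space_form c N)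
    (M : riemannian R 2) (hMo : oriented M) (S : spin_structure M)
    (phi : M -> N) (hphi : smooth_map phi) (hiso : isometric phi)
    (xi : unit_normal phi) (A : shape_operator xi)
    (eta : R[i]) (heta : 4 * eta ^+ 2 = c%:C%C)
    (U : set M) (hU : open U) :
  let H (x : M) : R[i] := (mean_curvature A x)%:C%C in
  (forall a b p q : M -> R[i], factorization c eta S A U a b p q ->
     exists beta : M -> R[i],
       [/\ csmooth_on U beta,
           forall x, U x ->
             [/\ a x = H x, b x = beta x + 2 * eta, p x = - H x
               & q x = beta x]
         & forall beta' : M -> R[i],
             (forall x, U x ->
               [/\ a x = H x, b x = beta' x + 2 * eta, p x = - H x
                 & q x = beta' x]) ->
             forall x, U x -> beta' x = beta x]) /\
  (forall beta : M -> R[i], csmooth_on U beta ->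
     (factorization c eta S A U
        H (fun x => beta x + 2 * eta) (fun x => - H x) beta
      <->
      forall x, U x ->
        (forall i, dom i x -> cgrad i beta x = cgrad i H x *m cJ S i x) /\
        beta x * (beta x + 2 * eta)
          + (norm2_shape A x)%:C%C - (2 * c)%:C%C = 0)).
Proof.
move=> H.
have eta0 : eta != 0.
  apply/eqP => e0; move: heta hc;
    rewrite e0 expr0n mulr0 => /(congr1 (@complex.Re R)) /= <-.
  by rewrite eqxx.
split=> [a b p q HF|beta sbeta].
  have [_ _ _ sq {}HF] := (factorizationP c eta S A a b p q hU).1 HF.
  exists q; split=> // [x Ux|beta' Hbeta' x Ux];
    last by have [_ _ _ ->] := Hbeta' x Ux.
  have [pa bq _ _ [_ aqbp]] := HF _ x (dom_chart_at x) Ux.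
  have pE : p x = - a x by apply/eqP; rewrite -addr_eq0 pa.
  have bE : b x = q x + 2 * eta.
    by apply/eqP; rewrite -subr_eq0 opprD addrA bq.
  (* Substituting [p = - a] and [b = q + 2 eta] cancels the products [a q] in the [omega]
     equation. *)
  have aE : a x = H x.
    have : 2 * eta * (H x - a x) = 0 by rewrite -aqbp bE pE; ring.
    move/eqP; rewrite !mulf_eq0 pnatr_eq0 (negbTE eta0) /= subr_eq0.
    by move/eqP.
  by rewrite pE aE.
have sH i : cchart_smooth i U H.
  exact/cchart_smooth_real/chart_smooth_mean_curvature.
have HbP := (csmooth_onP U beta).1 sbeta.
have sNH i : cchart_smooth i U (fun x => - H x) by exact: cchart_smoothN.
have csb : csmooth_on U (fun x => beta x + 2 * eta).
  by apply/csmooth_onP => i; apply: cchart_smoothD => //;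
    exact: cchart_smooth_cst.
have cdifN i x v : dom i x -> U x ->
    cdif i (fun y => - H y) x v = - cdif i H x v.
  move=> dx Ux; apply/eqP; rewrite -addr_eq0 -(cdifD v (sNH i) (sH i) dx Ux).
  by rewrite (_ : (fun y => _) = (fun=> 0)) ?cdif_cst //; apply/funext => y;
    rewrite addNr.
(* The square of [H] from [a p] cancels the one in the zero-order coefficient, leaving minus the
   stated quadratic expression. *)
have KE x : H x * - H x - (beta x + 2 * eta) * beta x
    - ((norm2_shape A x - mean_curvature A x ^+ 2 - 2 * c)%:C)%C =
    - (beta x * (beta x + 2 * eta) + (norm2_shape A x)%:C%C - (2 * c)%:C%C).
  by rewrite /H !rmorphB rmorphXn /=; ring.
split.
  move=> /(factorizationP c eta S A _ _ _ _ hU)[_ _ _ _ HF] x Ux;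
    split=> [i dx|].
    have [_ _ + + _] := HF i x dx Ux; rewrite !cdifN // => h1 h2.
    apply/(cgrad_eq_J S dx hU (sH i) (HbP i) Ux); split.
      by apply/eqP; rewrite -subr_eq0 opprK -[_ + _]opprK opprD addrC h2 oppr0.
    by apply/eqP; rewrite -subr_eq0 addrC h1.
  have [_ _ _ _ [+ _]] := HF _ x (dom_chart_at x) Ux.
  by rewrite KE => /eqP; rewrite oppr_eq0 => /eqP.
move=> HB; apply/(factorizationP c eta S A _ _ _ _ hU); split=> //;
  [exact/csmooth_onP | exact/csmooth_onP |].
move=> i x dx Ux; have [gB eB] := HB x Ux.
have [h1 h2] := (cgrad_eq_J S dx hU (sH i) (HbP i) Ux).1 (gB i dx).
split; rewrite ?cdifN ?h1 ?h2 ?KE ?eB //; try by ring.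
(* The scalar equation is the hypothesis [eB]; the [omega] equation is an identity for this choice
   of coefficients. *)
by split; [rewrite oppr0 | ring].
Qed.
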